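(* Let $N\ge3$, $0<\lambda\le\Lambda$, $p,q>0$, $pq>1$, and let the sign $\pm$ be fixed. If $(p,q)\in\mathcal{R}_d^\pm$ and $(u,v)$ is a regular radial solution of $$\mathcal{M}^\pm_{\lambda,\Lambda}(D^2u)+v^p=0,\qquad \mathcal{M}^\pm_{\lambda,\Lambda}(D^2v)+u^q=0,\qquad u,v>0\quad\text{in }B_R,\qquad u=v=0\ \text{on }\partial B_R,$$ for some $R>0$, then $u$ and $v$, as functions of $r=|x|$, change concavity only once.
   Context: Pucci operators: for a symmetric $N\times N$ matrix $A$ with eigenvalues $e_1,\dots,e_N$, $\mathcal{M}^+_{\lambda,\Lambda}(A)=\Lambda\sum_{e_i>0}e_i+\lambda\sum_{e_i<0}e_i$ and $\mathcal{M}^-_{\lambda,\Lambda}(A)=\lambda\sum_{e_i>0}e_i+\Lambda\sum_{e_i<0}e_i$. $\tilde N_+=\frac{\lambda}{\Lambda}(N-1)+1$, $\tilde N_-=\frac{\Lambda}{\lambda}(N-1)+1$. Regions (in $p,q>0$): $$\mathcal{R}_d^+=\Big\{\tfrac{N}{p+1}+\tfrac{\tilde N_+}{q+1}>N-2,\ \tfrac{\tilde N_+}{p+1}+\tfrac{N}{q+1}>N-2,\ pq>1\Big\},$$ $$\mathcal{R}_d^-=\Big\{\tfrac{N}{p+1}+\tfrac{\tilde N_-}{q+1}>\tilde N_--2,\ \tfrac{\tilde N_-}{p+1}+\tfrac{N}{q+1}>\tilde N_--2,\ pq>1\Big\}.$$ Solutions are classical; regular means that $u,v$, together with their derivatives,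 are continuously defined at $x=0$. $B_R$ is the ball of radius $R$ centered at $0$. ''Change concavity only once'' means that the second derivative with respect to $r$ changes sign exactly once in $(0,R)$. *)

(* Defs.v *)
From mathcomp Require Import all_boot all_order all_algebra.
From mathcomp Require Import all_classical all_reals all_analysis.
Import Order.TTheory GRing.Theory Num.Theory numFieldNormedType.Exports.

Set Implicit Arguments.
Unset Strict Implicit.
Unset Printing Implicit Defensive.

Local Open Scope classical_set_scope.
Local Open Scope ring_scope.

(* The library norm on ['rV[R]_N] is the sup norm. *)
Definition enorm (R : realType) (N : nat) (x : 'rV[R]_N) : R :=
  Num.sqrt (\sum_(i < N) x 0 i ^+ 2).

Definition eball (R : realType) (N : nat) (rho : R) : set 'rV[R]_N :=
  [set x | enorm x < rho].

Definition ecball (R : realType) (N : nat) (rho : R) : set 'rV[R]_N :=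
  [set x | enorm x <= rho].

Definition esphere (R : realType) (N : nat) (rho : R) : set 'rV[R]_N :=
  [set x | enorm x = rho].

Definition partial (R : realType) (N : nat) (i : 'I_N) (u : 'rV[R]_N -> R) :
    'rV[R]_N -> R :=
  fun x => 'D_(delta_mx 0 i) u x.

Definition hessian (R : realType) (N : nat) (u : 'rV[R]_N -> R)
    (x : 'rV[R]_N) : 'M[R]_N :=
  \matrix_(i, j) partial j (partial i u) x.

(* Meant for an open set [A]: derivability and continuity at a point of [A]
   are taken in the whole space, so they only involve values near it. *)
Definition C2_on (R : realType) (N : nat) (A : set 'rV[R]_N)
    (u : 'rV[R]_N -> R) : Prop :=
  forall x, A x ->
    [/\ {for x, continuous u},
        forall i, derivable u x (delta_mx 0 i)
                  /\ {for x, continuous (partial i u)}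
      & forall i j, derivable (partial i u) x (delta_mx 0 j)
                    /\ {for x, continuous (partial j (partial i u))}].

(* The eigenvalues repeated with algebraic multiplicity, in an unspecified
   order; a junk value when the characteristic polynomial does not split over
   [R], which does not happen for symmetric matrices. *)
Definition eigenvalues (R : realType) (N : nat) (A : 'M[R]_N) : seq R :=
  xget [::] [set e : seq R | char_poly A = \prod_(a <- e) ('X - a%:P)].

Lemma eigenvaluesP (R : realType) (N : nat) (A : 'M[R]_N) (e : seq R) :
  char_poly A = \prod_(a <- e) ('X - a%:P) -> perm_eq (eigenvalues A) e.
Proof.
move=> Ae; apply: prod_XsubC_eq; rewrite -Ae.
by have := xgetPex [::] (ex_intro
  [set e : seq R | char_poly A = \prod_(a <- e) ('X - a%:P)] e Ae).
Qed.

Variant pucci_sign : Set := PucciPlus | PucciMinus.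

Definition pucci (R : realType) (s : pucci_sign) (lam Lam : R) (N : nat)
    (A : 'M[R]_N) : R :=
  let pos := \sum_(a <- eigenvalues A | 0 < a) a in
  let neg := \sum_(a <- eigenvalues A | a < 0) a in
  match s with
  | PucciPlus => Lam * pos + lam * neg
  | PucciMinus => lam * pos + Lam * neg
  end.

(* The dimension-like numbers \tilde N_+ and \tilde N_-. *)
Definition Ntilde (R : realType) (s : pucci_sign) (lam Lam : R) (N : nat) : R :=
  match s with
  | PucciPlus => lam / Lam * (N%:R - 1) + 1
  | PucciMinus => Lam / lam * (N%:R - 1) + 1
  end.

Definition region_d (R : realType) (s : pucci_sign) (lam Lam : R) (N : nat) :
    set (R * R) :=
  [set pq | let p := pq.1 in let q := pq.2 in
    let M := Ntilde s lam Lam N in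
    let K := match s with PucciPlus => N%:R | PucciMinus => M end in
    [/\ 0 < p, 0 < q,
        K - 2 < N%:R / (p + 1) + M / (q + 1),
        K - 2 < M / (p + 1) + N%:R / (q + 1)
      & 1 < p * q]].

(* Classical solutions, of class C^2 in the whole open ball (the origin
   included, which is the regularity condition) and continuous up to the
   boundary. Values outside the closed ball are irrelevant. *)
Definition regular_solution (R : realType) (s : pucci_sign) (lam Lam : R)
    (N : nat) (p q rho : R) (u v : 'rV[R]_N -> R) : Prop :=
  [/\ C2_on (eball rho) u /\ C2_on (eball rho) v,
      {within ecball rho, continuous u} /\ {within ecball rho, continuous v},
      forall x, eball rho x ->
        pucci s lam Lam (hessian u x) + v x `^ p = 0
        /\ pucci s lam Lam (hessian v x) + u x `^ q = 0,
      forall x, eball rho x -> 0 < u x /\ 0 < v x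
    & forall x, esphere rho x -> u x = 0 /\ v x = 0].

Definition radial_profile (R : realType) (N : nat) (rho : R)
    (u : 'rV[R]_N -> R) (U : R -> R) : Prop :=
  forall x, ecball rho x -> u x = U (enorm x).

(* [f] has opposite weak signs on the two sides of some point, and takes both
   strict signs; [e] is the sign of [f] on the right. Zeros of [f] which are
   not accompanied by a change of sign are not counted. *)
Definition changes_sign_once (R : realType) (f : R -> R) (a b : R) : Prop :=
  exists (r0 e : R),
    [/\ a < r0 < b, e = 1 \/ e = -1,
        (forall r, a < r < r0 -> e * f r <= 0)
        /\ (exists2 r, a < r < r0 & e * f r < 0)
      & (forall r, r0 < r < b -> 0 <= e * f r)
        /\ (exists2 r, r0 < r < b & 0 < e * f r)].

Definition changes_concavity_once (R : realType) (rho : R) (U : R -> R) : Prop :=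
  changes_sign_once (U^`(2))%classic 0 rho.

(* Main.v *)
Require Import Defs.
From mathcomp Require Import all_boot all_order all_algebra.
From mathcomp Require Import all_classical all_reals all_analysis.
From mathcomp Require Import ring lra.
Import Order.TTheory GRing.Theory Num.Theory numFieldNormedType.Exports.
Set Implicit Arguments.
Unset Strict Implicit.
Unset Printing Implicit Defensive.
Local Open Scope classical_set_scope.
Local Open Scope ring_scope.

(** Along a radial solution put X = - r u' / u, Z = - r v^p / u' and, for the
    other equation, Y = - r v' / v, W = - r u^q / v'. With g = r u'' / u', which
    is an increasing function of Z vanishing at Z = a (N - 1), these satisfy
    r X' = X (X + 1 + g Z) and r Z' = Z (1 - g Z - p Y), so u is concave exactly
    where Z >= a (N - 1). If X and Y are nondecreasing then Z and W are
    nonincreasing (a point with r Z' > 0 would propagate back to r = 0, where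
    1 - g Z - p Y tends to 0), and the concavity changes only once.

    If only Y stopped increasing, W would keep decreasing and Y would decrease
    up to the end, which contradicts v(R) = 0. So at some first s both X and Y
    have stopped increasing, u and v both being convex there. The
    Pohozaev-type function psi = X Y - X (1 - g Z) / (p + 1)
    - Y (1 - g W) / (q + 1) is then shown to be negative at s by algebra, but
    nonnegative on (0, s] because in each of the four concavity regimes the
    inequalities defining the region make u v psi / r strictly increase where
    psi < 0. *)

(** * One-variable calculus: monotonicity and first sign changes *)

Section RealAnalysis.
Context {R : realType}.
Implicit Types (f df : R -> R) (x y a b : R).

Lemma itv_within_continuous f x y :
  (forall z, x <= z <= y -> {for z, continuous f}) ->
  {within `[x, y], continuous f}.
Proof.
move=> fc; apply: continuous_in_subspaceT => z.
by rewrite inE /= in_itv /=; apply: fc.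
Qed.

Lemma is_derive1_continuous f x d : is_derive x 1 f d -> {for x, continuous f}.
Proof. by move=> [fx _]; apply/differentiable_continuous/derivable1_diffP. Qed.

(** The derivative rules from here to [is_derive1X] are stated for functions written pointwise, so
    that they compose as proof terms and [ring] or [field] checks the resulting derivative. *)
Lemma is_derive1D f g x d e : is_derive x 1 f d -> is_derive x 1 g e ->
  is_derive x 1 (fun z => f z + g z) (d + e).
Proof. exact: is_deriveD. Qed.

Lemma is_derive1B f g x d e : is_derive x 1 f d -> is_derive x 1 g e ->
  is_derive x 1 (fun z => f z - g z) (d - e).
Proof. exact: is_deriveB. Qed.

Lemma is_derive1N f x d : is_derive x 1 f d ->
  is_derive x 1 (fun z => - f z) (- d).
Proof. exact: is_deriveN. Qed.

Lemma is_derive1M f g x d e : is_derive x 1 f d -> is_derive x 1 g e ->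
  is_derive x 1 (fun z => f z * g z) (f x * e + g x * d).
Proof. exact: is_deriveM. Qed.

Lemma is_derive1C (k : R) x : is_derive x 1 (fun _ : R => k) 0.
Proof. exact: is_derive_cst. Qed.

Lemma is_derive1I x : is_derive x 1 (fun z : R => z) 1.
Proof. exact: is_derive_id. Qed.

Lemma is_derive1V f x d : f x != 0 -> is_derive x 1 f d ->
  is_derive x 1 (fun z => (f z)^-1) (- (f x ^- 2 * d)).
Proof. by move=> fx fd; rewrite -mulNr; exact: is_deriveV. Qed.

Lemma is_derive1X f x d k : is_derive x 1 f d ->
  is_derive x 1 (fun z => f z ^+ k) (k%:R * f x ^+ k.-1 * d).
Proof.
move=> fd; have : is_derive x 1 (f ^+ k) ((k%:R * f x ^+ k.-1) *: d).
  exact: is_deriveX.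
by congr is_derive; apply/funext => z; elim: k => // k IH; rewrite !exprS -IH.
Qed.

Lemma derive_ge0_le f df x y : x <= y ->
  (forall z, x <= z <= y -> is_derive z 1 f (df z)) ->
  (forall z, x < z < y -> 0 <= df z) -> f x <= f y.
Proof.
rewrite le_eqVlt => /predU1P[->//|xy] dfE df0.
have [||c] := @MVT R f df x y xy.
- by move=> z; rewrite in_itv /= => /andP[xz zy]; apply: dfE; rewrite !ltW.
- by apply: itv_within_continuous => z /dfE /is_derive1_continuous.
rewrite in_itv /= => cxy fE; rewrite -subr_ge0 fE.
by rewrite mulr_ge0 ?df0 // subr_ge0 ltW.
Qed.

Lemma derive_le0_ge f df x y : x <= y ->
  (forall z, x <= z <= y -> is_derive z 1 f (df z)) ->
  (forall z, x < z < y -> df z <= 0) -> f y <= f x.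
Proof.
move=> xy dfE df0; rewrite -lerN2.
apply: (@derive_ge0_le (- f) (- df)) => // z zxy.
- by have := dfE z zxy => ?; apply: is_deriveN.
- by rewrite [_ z]/(- df z) oppr_ge0 df0.
Qed.

Lemma derive_gt0_near_left f x d : is_derive x 1 f d -> 0 < d ->
  \forall y \near x^'-, f y < f x.
Proof.
move=> [fx dfx] d0; have : (h^-1 *: ((f \o shift x) (h *: 1) - f x)) @[h --> 0^'] --> d.
  by rewrite -dfx; exact: fx.
move=> /(cvgr_gt _) /(_ _ d0) /nbhs_ballP[/= e e0 H].
apply/nbhs_left0P; exists e => // h /= + h0.
rewrite sub0r normrN => he.
have := H (- h).
rewrite /ball /= sub0r opprK oppr_eq0 gt_eqF // => /(_ he isT).
rewrite /= scaler1 invrN scaleNr oppr_gt0 [- h + x]addrC.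
by rewrite [_ *: _]mulrC pmulr_llt0 ?invr_gt0 // subr_lt0.
Qed.

(** The point is the infimum of the set where [f] is nonpositive; by continuity it belongs to that
    set. *)
Lemma first_nonpos f a b : a < b ->
  (forall z, a <= z <= b -> {for z, continuous f}) -> 0 < f a -> f b <= 0 ->
  exists2 t, a < t <= b & f t <= 0 /\ forall r, a <= r < t -> 0 < f r.
Proof.
move=> ab fc fa fb.
pose S := [set r | a <= r <= b /\ f r <= 0].
have Sb : S b by split; rewrite ?lexx ?(ltW ab).
have Slb : lbound S a by move=> r [/andP[]].
have Sinf : has_inf S by split; [exists b|exists a].
have at_ : a <= inf S by apply: lb_le_inf => //; exists b.
have tb : inf S <= b by apply: ge_inf => //; exists a.
have before r : a <= r < inf S -> 0 < f r.
  move=> /andP[ar rt]; rewrite ltNge; apply/negP => fr.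
  have : inf S <= r.
    apply: ge_inf; first by exists a.
    by split=> //; rewrite ar (ltW (lt_le_trans rt tb)).
  by rewrite leNgt rt.
have ft : f (inf S) <= 0.
  rewrite leNgt; apply/negP => ft.
  have /= := fc (inf S); rewrite at_ tb => /(_ isT) /(cvgr_gt _) /(_ _ ft).
  move=> /nbhs_ballP[e /= e0 H].
  have [r Sr rt] := inf_adherent e0 Sinf.
  have tr : inf S <= r by apply: ge_inf => //; exists a.
  have : 0 < f r.
    by apply: H; rewrite /ball /= distrC ger0_norm ?subr_ge0 // ltrBlDl.
  by rewrite ltNge; case: Sr => _ ->.
exists (inf S); last by split.
rewrite tb andbT lt_neqAle at_ andbT; apply/eqP => at'.
by move: ft; rewrite -at' leNgt fa.
Qed.

Lemma last_nonpos f a b : a < b ->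
  (forall z, a <= z <= b -> {for z, continuous f}) -> f a <= 0 -> 0 < f b ->
  exists2 t, a <= t < b & f t <= 0 /\ forall r, t < r <= b -> 0 < f r.
Proof.
move=> ab fc fa fb.
have [|z /andP[za zb]|||t /andP[bt ta] [ft H]] :=
    @first_nonpos (f \o -%R) (- b) (- a).
- by rewrite ltrN2.
- apply: continuous_comp; first exact: oppr_continuous.
  by apply: fc; rewrite lerNr zb lerNl za.
- by rewrite /= opprK.
- by rewrite /= opprK.
exists (- t); first by rewrite lerNr ta ltrNl bt.
split=> // r /andP[tr rb].
by have := H (- r); rewrite /= opprK; apply; rewrite lerN2 rb ltrNl.
Qed.

(** The infimum is now that of the set where [f < 0]: [f] may touch zero before [t], but it is
    negative at points arbitrarily close to [t] on the right, which [first_nonpos] would not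
    give. *)
Lemma first_neg f a b : a < b ->
  (forall z, a <= z <= b -> {for z, continuous f}) -> 0 < f a -> f b < 0 ->
  exists2 t, a < t < b & [/\ f t = 0, forall r, a <= r <= t -> 0 <= f r
    & forall e, 0 < e -> exists2 r, t < r < t + e & r <= b /\ f r < 0].
Proof.
move=> ab fc fa fb.
pose S := [set r | a <= r <= b /\ f r < 0].
have Sb : S b by split; rewrite ?lexx ?(ltW ab).
have Slb : lbound S a by move=> r [/andP[]].
have Sinf : has_inf S by split; [exists b|exists a].
have at_ : a <= inf S by apply: lb_le_inf => //; exists b.
have tb : inf S <= b by apply: ge_inf => //; exists a.
have fct : {for inf S, continuous f} by apply: fc; rewrite at_ tb.
have before r : a <= r < inf S -> 0 <= f r.
  move=> /andP[ar rt]; rewrite leNgt; apply/negP => fr.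
  have : inf S <= r.
    apply: ge_inf; first by exists a.
    by split=> //; rewrite ar (ltW (lt_le_trans rt tb)).
  by rewrite leNgt rt.
have ft0 : f (inf S) <= 0.
  rewrite leNgt; apply/negP => ft.
  have /(cvgr_gt _) /(_ _ ft) /nbhs_ballP[e /= e0 H] := fct.
  have [r Sr rt] := inf_adherent e0 Sinf.
  have tr : inf S <= r by apply: ge_inf => //; exists a.
  have : 0 < f r.
    by apply: H; rewrite /ball /= distrC ger0_norm ?subr_ge0 // ltrBlDl.
  by case: Sr => _ fr; rewrite ltNge (ltW fr).
have lt_at : a < inf S.
  rewrite lt_neqAle at_ andbT; apply/eqP => at'.
  by move: ft0; rewrite -at' leNgt fa.
have ft1 : 0 <= f (inf S).
  rewrite leNgt; apply/negP => ft.
  have /(cvgr_lt _) /(_ _ ft) /nbhs_ballP[e /= e0 H] := fct.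
  pose r := Num.max a (inf S - e / 2).
  have rt : r < inf S by rewrite gt_max lt_at ltrBlDr ltrDl divr_gt0.
  have : f r < 0.
    apply: H; rewrite /ball /= ger0_norm ?subr_ge0 ?(ltW rt) //.
    rewrite ltrBlDr -ltrBlDl lt_max; apply/orP; right.
    by rewrite ltrD2l ltrN2; lra.
  by rewrite ltNge before // rt andbT le_max lexx.
have ft : f (inf S) = 0 by apply/eqP; rewrite eq_le ft0 ft1.
exists (inf S).
  rewrite lt_at lt_neqAle tb andbT; apply/eqP => bt.
  by move: fb; rewrite -bt ft ltxx.
split=> // [r /andP[ar]|e e0].
  by rewrite le_eqVlt => /predU1P[->//|rt]; apply: before; rewrite ar.
have [r [/andP[ar rb] fr] rt] := inf_adherent e0 Sinf.
have tr : inf S <= r by apply: ge_inf; [exists a|split=> //; rewrite ar].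
exists r => //; rewrite rt andbT lt_neqAle tr andbT.
by apply/eqP => tr'; move: fr; rewrite -tr' ft ltxx.
Qed.

(** A monotonicity principle without derivatives, for functions with kinks: a minimizer of [f] on
    [[y, s]] other than [y] would have smaller values just to its left. *)
Lemma left_drop_lt f y s : y < s ->
  (forall z, y <= z <= s -> {for z, continuous f}) -> f s < 0 ->
  (forall x, y < x <= s -> f x < 0 -> \forall z \near x^'-, f z < f x) ->
  f y < f s.
Proof.
move=> ys fc fs drop; rewrite ltNge; apply/negP => fsy.
have [|m] := EVT_min (ltW ys) (f := f); first exact: itv_within_continuous.
have drops x : y < x <= s -> f x < 0 -> exists2 z, y <= z <= s & f z < f x.
  move=> /andP[yx xs] fx; have := drop x.
  rewrite yx xs => /(_ isT fx) H; near x^'- => z; exists z.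
    apply/andP; split; first by near: z; exact: nbhs_left_ge.
    by apply: le_trans xs; near: z; exact: nbhs_left_le.
  by near: z.
rewrite in_itv /= => /andP[ym ms] fm.
have [ym'|] := ltP y m.
  have fm0 : f m < 0.
    by apply: le_lt_trans fs; apply: fm; rewrite in_itv /= lexx ltW.
  have [|z zys] := drops m _ fm0; first by rewrite ym'.
  by rewrite ltNge fm // in_itv.
(* With the minimum at [y] and [f s <= f y], the point [s] is a minimizer as well, so the drop at
   [s] is impossible. *)
move=> my; have {my} ym' : m = y by apply/eqP; rewrite eq_le my ym.
subst m; have [|z zys] := drops s _ fs; first by rewrite ys lexx.
by rewrite ltNge (le_trans fsy) // fm // in_itv.
Unshelve. all: by end_near. Qed.

End RealAnalysis.
(* r U'' / U' as a function of Z = - r V^p / U'. Here a weighs the negative and A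
   the positive eigenvalues in the Pucci operator: since U' < 0, curv >= 0 means
   that U is concave. *)
Definition curv (R : realType) (a A n z : R) : R :=
  Num.max (z - a * (n - 1)) 0 / a + Num.min (z - a * (n - 1)) 0 / A.

(* X = - r U' / U, Z = - r V^p / U' and Y = - r V' / V, where (U, V) is the pair
   of radial profiles; only the equation for U enters. *)
Record half_orbit (R : realType) (a A n p rho : R) (U X Z Y : R -> R) : Prop :=
  HalfOrbit {
    orbit_U_gt0 : forall r, 0 < r < rho -> 0 < U r;
    orbit_X_gt0 : forall r, 0 < r < rho -> 0 < X r;
    orbit_Z_gt0 : forall r, 0 < r < rho -> 0 < Z r;
    orbit_dU : forall r, 0 < r < rho -> is_derive r 1 U (- (X r * U r / r));
    orbit_dX : forall r, 0 < r < rho ->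
      is_derive r 1 X (X r * (X r + 1 + curv a A n (Z r)) / r);
    orbit_dZ : forall r, 0 < r < rho ->
      is_derive r 1 Z (Z r * (1 - curv a A n (Z r) - p * Y r) / r);
    orbit_U0 : exists u0 : R, U r @[r --> (0 : R)^'+] --> u0;
    orbit_X0 : X r / r @[r --> (0 : R)^'+] --> 0;
    orbit_Z0 : Z r @[r --> (0 : R)^'+] --> a * n;
    orbit_Urho : U r @[r --> rho^'-] --> 0 }.

(** * Monotonicity and continuity of the curvature function *)

Section Curvature.
Context {R : realType} {a A n : R}.
Hypotheses (a0 : 0 < a) (A0 : 0 < A).
Local Notation g := (curv a A n).
Local Notation c := (a * (n - 1)).

Lemma curv_concave z : c <= z -> g z = (z - c) / a.
Proof.
by rewrite -subr_ge0 => cz; rewrite /curv max_l // min_r // mul0r addr0.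
Qed.

Lemma curv_convex z : z <= c -> g z = (z - c) / A.
Proof.
by rewrite -subr_le0 => cz; rewrite /curv max_r // min_l // mul0r add0r.
Qed.

Lemma curv_mono : {mono g : x y / x <= y}.
Proof.
apply: le_mono => x y xy.
have [cx|xc] := leP c x.
  rewrite (curv_concave cx) (curv_concave (le_trans cx (ltW xy))).
  by rewrite ltr_pM2r ?invr_gt0 // ltrD2r.
rewrite (curv_convex (ltW xc)).
have [cy|yc] := leP c y.
  rewrite (curv_concave cy) (@lt_le_trans _ _ 0) //.
    by rewrite pmulr_llt0 ?invr_gt0 // subr_lt0.
  by rewrite divr_ge0 ?(ltW a0) // subr_ge0.
by rewrite (curv_convex (ltW yc)) ltr_pM2r ?invr_gt0 // ltrD2r.
Qed.

(** The limit of [r U'' / U'] at the origin, since [Z] tends to [a * n] there. *)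
Lemma curv_center : g (a * n) = 1.
Proof.
rewrite curv_concave; last by rewrite ler_pM2l // gerBl.
by field; rewrite gt_eqF.
Qed.

Lemma continuous_curv : continuous g.
Proof.
(* An affine part plus a multiple of an absolute value, which makes continuity at the kink [c]
   evident. *)
have gE : g = fun z => (z - c) * ((a^-1 + A^-1) / 2)
                       + `|z - c| * ((a^-1 - A^-1) / 2).
  apply/funext => z; rewrite /curv.
  have [cz|zc] := leP c z.
    have cz0 : 0 <= z - c by rewrite subr_ge0.
    by rewrite max_l // min_r // ger0_norm //; field; rewrite !gt_eqF.
  have zc0 : z - c <= 0 by rewrite subr_le0 ltW.
  by rewrite max_r // min_l // ler0_norm //; field; rewrite !gt_eqF.
rewrite gE => z.
have zc : (x - c) @[x --> z] --> z - c by apply: cvgB; [exact: cvg_id|exact: cvg_cst].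
apply: cvgD; apply: cvgM; try exact: cvg_cst; first exact: zc.
by apply: cvg_norm; exact: zc.
Qed.

End Curvature.

(** * Monotonicity of [X] and [Z] along the orbits *)

Section HalfOrbits.
Context {R : realType} {a A n rho : R}.
Hypotheses (a0 : 0 < a) (A0 : 0 < A) (rho0 : 0 < rho).
Local Notation g := (curv a A n).
Implicit Types (U V X Y Z W : R -> R).

Section OneHalf.
Context {p : R} {U X Z Y : R -> R}.
Hypothesis H : half_orbit a A n p rho U X Z Y.

Lemma orbit_continuous r : 0 < r < rho ->
  [/\ {for r, continuous U}, {for r, continuous X} & {for r, continuous Z}].
Proof.
by move=> rr; split; apply: is_derive1_continuous;
  [exact: (orbit_dU H)|exact: (orbit_dX H)|exact: (orbit_dZ H)].
Qed.

Lemma curv_orbit_continuous r : 0 < r < rho -> {for r, continuous (g \o Z)}.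
Proof.
move=> rr; have [_ _ Zc] := orbit_continuous rr.
by apply: continuous_comp => //; exact: (continuous_curv a0 A0).
Qed.

Lemma growth_continuous r : 0 < r < rho ->
  {for r, continuous (fun r => X r + 1 + g (Z r))}.
Proof.
move=> rr; have [_ Xc _] := orbit_continuous rr.
apply: cvgD; last exact: curv_orbit_continuous.
by apply: cvgD; [exact: Xc|exact: cvg_cst].
Qed.

Lemma curv_orbit_cvg0 : g (Z r) @[r --> (0 : R)^'+] --> (1 : R).
Proof.
rewrite -(curv_center (A := A) (n := n) a0).
by apply: continuous_cvg (orbit_Z0 H); exact: (continuous_curv a0 A0).
Qed.

Lemma orbit_X_cvg0 : X r @[r --> (0 : R)^'+] --> (0 : R).
Proof.
have : X r / r * r @[r --> (0 : R)^'+] --> (0 * 0 : R).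
  by apply: cvgM (orbit_X0 H) _; apply: cvg_at_right_filter; exact: cvg_id.
rewrite mul0r; apply: cvg_trans; apply: near_eq_cvg.
by near=> r; rewrite divfK // gt_eqF.
Unshelve. all: by end_near. Qed.

Lemma growth_near0 : \forall r \near (0 : R)^'+, 0 < X r + 1 + g (Z r).
Proof.
have g0 : \forall r \near (0 : R)^'+, 0 < g (Z r).
  exact: cvgr_gt curv_orbit_cvg0 _ ltr01.
near=> r; have X0 : 0 < X r.
  by apply: (orbit_X_gt0 H); apply/andP; split; near: r;
    [exact: nbhs_right_gt|exact: nbhs_right_lt].
have gZ : 0 < g (Z r) by near: r; exact: g0.
by apply: addr_gt0 => //; exact: addr_gt0.
Unshelve. all: by end_near. Qed.

Lemma orbit_X_ndecr r1 r2 : 0 < r1 -> r1 <= r2 < rho ->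
  (forall r, r1 < r < r2 -> 0 <= X r + 1 + g (Z r)) -> X r1 <= X r2.
Proof.
move=> r10 /andP[r12 r2r] G; have inI z : r1 <= z <= r2 -> 0 < z < rho.
  by move=> /andP[/(lt_le_trans r10) -> /le_lt_trans ->].
apply: derive_ge0_le r12 (fun z zr => orbit_dX H (inI z zr)) _ => z zr.
have zr' : 0 < z < rho by apply: inI; case/andP: zr => *; rewrite !ltW.
case/andP: (zr') => z0 _.
by rewrite divr_ge0 ?(ltW z0) // mulr_ge0 ?G // ltW // (orbit_X_gt0 H).
Qed.

Lemma orbit_X_nincr r1 r2 : 0 < r1 -> r1 <= r2 < rho ->
  (forall r, r1 < r < r2 -> X r + 1 + g (Z r) <= 0) -> X r2 <= X r1.
Proof.
move=> r10 /andP[r12 r2r] G; have inI z : r1 <= z <= r2 -> 0 < z < rho.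
  by move=> /andP[/(lt_le_trans r10) -> /le_lt_trans ->].
apply: derive_le0_ge r12 (fun z zr => orbit_dX H (inI z zr)) _ => z zr.
have zr' : 0 < z < rho by apply: inI; case/andP: zr => *; rewrite !ltW.
case/andP: (zr') => z0 _.
by rewrite pmulr_lle0 ?invr_gt0 // pmulr_rle0 ?G // (orbit_X_gt0 H).
Qed.

Lemma orbit_Z_ndecr r1 r2 : 0 < r1 -> r1 <= r2 < rho ->
  (forall r, r1 < r < r2 -> 0 <= 1 - g (Z r) - p * Y r) -> Z r1 <= Z r2.
Proof.
move=> r10 /andP[r12 r2r] G; have inI z : r1 <= z <= r2 -> 0 < z < rho.
  by move=> /andP[/(lt_le_trans r10) -> /le_lt_trans ->].
apply: derive_ge0_le r12 (fun z zr => orbit_dZ H (inI z zr)) _ => z zr.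
have zr' : 0 < z < rho by apply: inI; case/andP: zr => *; rewrite !ltW.
case/andP: (zr') => z0 _.
by rewrite divr_ge0 ?(ltW z0) // mulr_ge0 ?G // ltW // (orbit_Z_gt0 H).
Qed.

Lemma orbit_Z_nincr r1 r2 : 0 < r1 -> r1 <= r2 < rho ->
  (forall r, r1 < r < r2 -> 1 - g (Z r) - p * Y r <= 0) -> Z r2 <= Z r1.
Proof.
move=> r10 /andP[r12 r2r] G; have inI z : r1 <= z <= r2 -> 0 < z < rho.
  by move=> /andP[/(lt_le_trans r10) -> /le_lt_trans ->].
apply: derive_le0_ge r12 (fun z zr => orbit_dZ H (inI z zr)) _ => z zr.
have zr' : 0 < z < rho by apply: inI; case/andP: zr => *; rewrite !ltW.
case/andP: (zr') => z0 _.
by rewrite pmulr_lle0 ?invr_gt0 // pmulr_rle0 ?G // (orbit_Z_gt0 H).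
Qed.

(** Until a first return to nonnegative values both [X] and [Z] are nonincreasing, hence so is
    [X + 1 + g Z], which cannot climb back to 0. *)
Lemma growth_stays_neg r1 s : 0 < r1 -> r1 <= s < rho ->
  (forall r, r1 <= r <= s -> 1 - g (Z r) - p * Y r <= 0) ->
  X r1 + 1 + g (Z r1) < 0 -> X s + 1 + g (Z s) < 0.
Proof.
move=> r10 /andP[]; rewrite le_eqVlt => /predU1P[<-//|r1s] sr m0 neg.
rewrite ltNge; apply/negP => pos.
have [||||t /andP[r1t ts] [ft before]] :=
    @first_nonpos R (fun r => - (X r + 1 + g (Z r))) r1 s.
- exact: r1s.
- move=> z /andP[/(lt_le_trans r10) z0 /le_lt_trans/(_ sr) zr].
  by apply: cvgN; apply: growth_continuous; rewrite z0 zr.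
- by rewrite oppr_gt0.
- by rewrite oppr_le0.
have tr : t < rho by apply: le_lt_trans sr.
have Xt : X t <= X r1.
  apply: orbit_X_nincr; rewrite ?tr ?andbT ?(ltW r1t) // => r /andP[r1r rt].
  by rewrite -oppr_ge0 ltW // before // rt (ltW r1r).
have Zt : Z t <= Z r1.
  apply: orbit_Z_nincr; rewrite ?tr ?andbT ?(ltW r1t) // => r /andP[r1r rt].
  by apply: m0; rewrite (ltW r1r) (le_trans (ltW rt)).
move: ft; rewrite oppr_le0 leNgt => /negP; apply.
apply: le_lt_trans neg; apply: lerD; last by rewrite (curv_mono a0 A0).
by rewrite lerD2r.
Qed.

End OneHalf.

(** While [1 - g Z - p Y] is positive, [Z] and [Y] are nondecreasing, so this quantity is
    nonincreasing in [r]: a positive value at [s] bounds it from below all the way to 0, against its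
    limit 0. *)
Lemma orbit_Z_decay p q U V X Y Z W s :
  half_orbit a A n p rho U X Z Y -> half_orbit a A n q rho V Y W X ->
  0 < p -> 0 < s < rho ->
  (forall r, 0 < r <= s -> 0 <= Y r + 1 + g (W r)) ->
  1 - g (Z s) - p * Y s <= 0.
Proof.
move=> H H' p0 /andP[s0 sr] G; rewrite leNgt; apply/negP => ms.
pose m r := 1 - g (Z r) - p * Y r.
have ltYs r1 r2 : 0 < r1 -> r1 <= r2 <= s -> Y r1 <= Y r2.
  move=> r10 /andP[r12 r2s]; apply: (orbit_X_ndecr H') => //.
    by rewrite r12 (le_lt_trans r2s).
  move=> r /andP[/(lt_trans r10) r0 rr2]; apply: G.
  by rewrite r0 (le_trans (ltW rr2)).
have mc r : 0 < r < rho -> {for r, continuous m}.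
  move=> rr; apply: cvgB; first apply: cvgB.
  - exact: cvg_cst.
  - exact: (curv_orbit_continuous H).
  - by apply: cvgM; [exact: cvg_cst|case: (orbit_continuous H' rr)].
have mono r : 0 < r <= s -> (forall z, r < z <= s -> 0 < m z) -> m s <= m r.
  move=> /andP[r0 rs] mpos; have rs' : r <= s < rho by rewrite rs.
  have Zrs : Z r <= Z s.
    apply: (orbit_Z_ndecr H) => // z /andP[rz zs].
    by apply: ltW; apply: mpos; rewrite rz ltW.
  rewrite lerB ?ler_pM2l ?ltYs ?rs ?lexx // lerB //.
  by rewrite (curv_mono a0 A0).
(* At the last point [t] before [s] where [m] is nonpositive, [mono] would give [m s <= m t]. *)
have mpos r : 0 < r <= s -> 0 < m r.
  move=> /andP[r0]; rewrite le_eqVlt => /predU1P[->//|rs].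
  rewrite ltNge; apply/negP => mr.
  have [|t /andP[rt ts] [mt after]] := last_nonpos rs _ mr ms.
    by move=> z /andP[/(lt_le_trans r0) z0 /le_lt_trans/(_ sr) zr]; apply: mc; rewrite z0 zr.
  have : m s <= m t by apply: mono => //; rewrite (lt_le_trans r0) //= ltW.
  by move=> /(lt_le_trans ms); rewrite ltNge mt.
have m0 : m r @[r --> (0 : R)^'+] --> (0 : R).
  rewrite -[X in _ --> X](_ : 1 - 1 - p * 0 = 0); last by rewrite mulr0; ring.
  apply: cvgB; first by apply: cvgB (curv_orbit_cvg0 H); exact: cvg_cst.
  by apply: cvgM; [exact: cvg_cst|exact: (orbit_X_cvg0 H')].
have small : \forall r \near (0 : R)^'+, m r < m s.
  exact: cvgr_lt m0 _ ms.
near (0 : R)^'+ => r.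
have r0 : 0 < r by near: r; exact: nbhs_right_gt.
have rs : r <= s by near: r; exact: nbhs_right_le.
have : m s <= m r.
  apply: mono; rewrite ?r0 // => z /andP[rz zs].
  by apply: mpos; rewrite (lt_trans r0).
by rewrite leNgt => /negP; apply; near: r; exact: small.
Unshelve. all: by end_near. Qed.

(* If X' took a negative value it would stay negative, so X would be bounded
   and U could not reach 0 at rho. *)
Lemma growth_ge0_of_partner p q U V X Y Z W :
  half_orbit a A n p rho U X Z Y -> half_orbit a A n q rho V Y W X ->
  0 < p ->
  (forall r, 0 < r < rho -> 0 <= Y r + 1 + g (W r)) ->
  forall r, 0 < r < rho -> 0 <= X r + 1 + g (Z r).
Proof.
move=> H H' p0 G r1 /andP[r10 r1r]; rewrite leNgt; apply/negP => neg.
have after r : r1 <= r < rho -> X r + 1 + g (Z r) < 0.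
  move=> /andP[r1r' rr]; apply: (growth_stays_neg H r10) neg; first by rewrite r1r'.
  move=> z /andP[/(lt_le_trans r10) z0 /le_lt_trans/(_ rr) zr].
  apply: (orbit_Z_decay H H') => //; rewrite ?z0 // => y /andP[y0 yz].
  by rewrite G // y0 (le_lt_trans yz).
have Xb r : r1 <= r < rho -> X r <= X r1.
  move=> /andP[r1r' rr]; apply: (orbit_X_nincr H) => //; first by rewrite r1r'.
  by move=> z /andP[r1z zr]; rewrite ltW // after // (ltW r1z) (lt_trans zr).
(* With an exponent at least [X r1], the derivative [U z ^ k (k + 1 - X)] of [U z ^ (k + 1)] is
   nonnegative after [r1]; this yields the positive lower bound [d] for [U] up to [rho]. *)
have [k Xk] : exists k : nat, X r1 <= k.+1%:R.
  exists (Num.truncn (X r1)); apply: ltW; exact: truncnS_gt.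
have Ub r : r1 <= r < rho -> U r1 * r1 ^+ k.+1 <= U r * rho ^+ k.+1.
  move=> /andP[r1r' rr].
  have r0 : 0 < r by apply: lt_le_trans r1r'.
  have : U r1 * r1 ^+ k.+1 <= U r * r ^+ k.+1.
    apply: (@derive_ge0_le _ (fun z => U z * z ^+ k.+1)
      (fun z => U z * (z ^+ k) * (k.+1%:R - X z))) r1r' _ _ => z.
      move=> /andP[/(lt_le_trans r10) z0 /le_lt_trans/(_ rr) zr].
      have dU : is_derive z 1 U (- (X z * U z / z)) by apply: (orbit_dU H); rewrite z0.
      apply: is_derive_eq.
        exact: (is_derive1M dU (is_derive1X k.+1 (is_derive1I z))).
      by rewrite /= exprS; field; rewrite gt_eqF.
    move=> /andP[r1z zr]; have z0 := lt_trans r10 r1z.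
    have zr' := lt_trans zr rr.
    rewrite mulr_ge0 // ?mulr_ge0 ?exprn_ge0 ?(ltW z0) // ?subr_ge0.
      by rewrite ltW // (orbit_U_gt0 H) // z0.
    by apply: le_trans Xk; apply: Xb; rewrite (ltW r1z).
  move=> /le_trans; apply; rewrite ler_pM2l ?(orbit_U_gt0 H) ?r0 //.
  by rewrite lerXn2r ?nnegrE ?(ltW r0) ?(ltW rho0) // ltW.
pose d := U r1 * r1 ^+ k.+1 / rho ^+ k.+1.
have d0 : 0 < d.
  by rewrite divr_gt0 ?exprn_gt0 // mulr_gt0 ?exprn_gt0 // (orbit_U_gt0 H) // r10.
have small : \forall r \near rho^'-, U r < d.
  exact: cvgr_lt (orbit_Urho H) _ d0.
near rho^'- => r.
have : d <= U r.
  rewrite ler_pdivrMr ?exprn_gt0 // Ub //; apply/andP; split; near: r;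
  [exact: nbhs_left_ge|exact: nbhs_left_lt].
by rewrite leNgt => /negP; apply; near: r; exact: small.
Unshelve. all: by end_near. Qed.

End HalfOrbits.
(* The effective dimension where the solution is concave ([true]) or convex
   ([false]); the latter is the \tilde N of the paper. *)
Definition regime (R : realType) (a A n : R) (b : bool) : R :=
  if b then n else a * (n - 1) / A + 1.

Definition in_regime (R : realType) (a n : R) (b : bool) (z : R) : Prop :=
  if b then a * (n - 1) <= z else z <= a * (n - 1).

(* The last expression is F + (1 - K) psi with K = max(n1, n2), where F >= 0 is
   the analogous expression for the Pohozaev weight r ^ K. *)
Lemma pohozaev_gt0 (R : realFieldType) (p q n1 n2 X Y P Q : R) :
  0 < p -> 0 < q -> 1 < n1 -> 1 < n2 -> 0 < X -> 0 < Y ->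
  Num.max n1 n2 - 2 <= n1 / (p + 1) + n2 / (q + 1) ->
  (n1 != n2 -> P <= (p + 1) * Y /\ Q <= (q + 1) * X) ->
  X * Y - X * P / (p + 1) - Y * Q / (q + 1) < 0 ->
  0 < X * Y * (3 - n1 * (p / (p + 1)) - n2 * (q / (q + 1)))
      + X * P / (p + 1) * (n1 - 1) + Y * Q / (q + 1) * (n2 - 1).
Proof.
move=> p0 q0 n10 n20 X0 Y0 crit PQ psi0.
have p10 : 0 < p + 1 by rewrite addr_gt0.
have q10 : 0 < q + 1 by rewrite addr_gt0.
have XY0 : 0 < X * Y by rewrite mulr_gt0.
have [n21|n12] := leP n2 n1; rewrite ?(max_l n21) ?(max_r (ltW n12)) in crit.
(* [F] splits into this term, which vanishes for equal dimensions, and the subcriticality term in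
   [F0]; strictness comes from [psi < 0] through [K0]. *)
- have Q0 : 0 <= (n1 - n2) * (Y * (X - Q / (q + 1))).
    have [->|/PQ[_ QX]] := eqVneq n1 n2; first by rewrite subrr mul0r.
    rewrite mulr_ge0 ?subr_ge0 // mulr_ge0 ?(ltW Y0) // subr_ge0.
    by rewrite ler_pdivrMr // mulrC.
  have K0 : 0 < (1 - n1) * (X * Y - X * P / (p + 1) - Y * Q / (q + 1)).
    by rewrite nmulr_rgt0 // subr_lt0.
  have F0 : 0 <= X * Y * (n1 / (p + 1) + n2 / (q + 1) - (n1 - 2)).
    by rewrite mulr_ge0 ?(ltW XY0) // subr_ge0.
  have := ltr_wpDl Q0 (ltr_wpDl F0 K0); congr (0 < _).
  by field; rewrite !gt_eqF.
- have P0 : 0 <= (n2 - n1) * (X * (Y - P / (p + 1))).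
    have [|PY _] := PQ; first by rewrite lt_eqF.
    rewrite mulr_ge0 ?subr_ge0 ?(ltW n12) // mulr_ge0 ?(ltW X0) // subr_ge0.
    by rewrite ler_pdivrMr // mulrC.
  have K0 : 0 < (1 - n2) * (X * Y - X * P / (p + 1) - Y * Q / (q + 1)).
    by rewrite nmulr_rgt0 // subr_lt0.
  have F0 : 0 <= X * Y * (n1 / (p + 1) + n2 / (q + 1) - (n2 - 2)).
    by rewrite mulr_ge0 ?(ltW XY0) // subr_ge0.
  have := ltr_wpDl P0 (ltr_wpDl F0 K0); congr (0 < _).
  by field; rewrite !gt_eqF.
Qed.

(** Both regimes are closed: for [y] close to [x] the regime chosen at [y] still contains [Z x],
    even when [Z x] is the threshold, which belongs to both. *)
Lemma in_regime_near (R : realType) (a n x : R) (Z : R -> R) :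
  {for x, continuous Z} ->
  \forall y \near x^'-, in_regime a n (a * (n - 1) <= Z y) (Z x).
Proof.
move=> Zx; have Zx' : Z y @[y --> x^'-] --> Z x by exact: cvg_at_left_filter.
have [lt|gt|eq] := ltgtP (Z x) (a * (n - 1)).
- have : \forall y \near x^'-, Z y < a * (n - 1) by exact: cvgr_lt Zx' _ lt.
  apply: filterS => y yc.
  by rewrite leNgt yc /in_regime /= ltW.
- have : \forall y \near x^'-, a * (n - 1) < Z y by exact: cvgr_gt Zx' _ gt.
  apply: filterS => y yc.
  by rewrite (ltW yc) /in_regime /= ltW.
- by apply: nearW => y; rewrite /in_regime eq; case: ifP.
Qed.

(** * The sign of a Pohozaev-type energy *)

Section Energy.
Context {R : realType} {a A n rho p q : R} {U V X Y Z W : R -> R}.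
Hypotheses (a0 : 0 < a) (A0 : 0 < A) (n1 : 1 < n) (rho0 : 0 < rho).
Hypotheses (p0 : 0 < p) (q0 : 0 < q).
Hypothesis H : half_orbit a A n p rho U X Z Y.
Hypothesis H' : half_orbit a A n q rho V Y W X.
Local Notation g := (curv a A n).
Local Notation c := (a * (n - 1)).
Local Notation m := (regime a A n).
Hypothesis subcritical : forall b b',
  Num.max (m b) (m b') - 2 <= m b / (p + 1) + m b' / (q + 1).

Let psi r := X r * Y r - X r * (1 - g (Z r)) / (p + 1)
             - Y r * (1 - g (W r)) / (q + 1).
Let energy r := U r * V r / r * psi r.

(** [energy] with each [curv] replaced by one of its affine branches. It is differentiable, whereas
    [energy] may have a kink where [Z] or [W] crosses [c]. *)
Let smooth b b' r := U r * V r / r *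
  (X r * Y r - X r * (1 - (Z r - c) / (if b then a else A)) / (p + 1)
   - Y r * (1 - (W r - c) / (if b' then a else A)) / (q + 1)).

Lemma regime_gt1 b : 1 < m b.
Proof.
rewrite /regime; case: b => //.
by rewrite ltrDr divr_gt0 // mulr_gt0 // subr_gt0.
Qed.

Lemma curv_in_regime b z : in_regime a n b z ->
  g z = (z - c) / (if b then a else A).
Proof. by case: b; [exact: curv_concave|exact: curv_convex]. Qed.

Lemma energy_smooth b b' r : in_regime a n b (Z r) -> in_regime a n b' (W r) ->
  energy r = smooth b b' r.
Proof.
by move=> bZ bW; rewrite /energy /psi /smooth !(curv_in_regime bZ) !(curv_in_regime bW).
Qed.

Lemma smooth_derive b b' r : 0 < r < rho ->
  in_regime a n b (Z r) -> in_regime a n b' (W r) ->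
  is_derive r 1 (smooth b b')
    (U r * V r / r ^+ 2 *
      (X r * Y r * (3 - m b * (p / (p + 1)) - m b' * (q / (q + 1)))
       + X r * (1 - g (Z r)) / (p + 1) * (m b - 1)
       + Y r * (1 - g (W r)) / (q + 1) * (m b' - 1))).
Proof.
move=> rr bZ bW; have r0 : r != 0 by case/andP: rr => ? _; rewrite gt_eqF.
have := (orbit_dU H rr, orbit_dX H rr, orbit_dZ H rr).
have := (orbit_dU H' rr, orbit_dX H' rr, orbit_dZ H' rr).
rewrite !(curv_in_regime bZ) !(curv_in_regime bW).
move=> [[dV dY] dW] [[dU dX] dZ].
have half_derive (e s : R) (f h : R -> R) df dh :
    is_derive r 1 f df -> is_derive r 1 h dh ->
    is_derive r 1 (fun r => f r * (1 - (h r - c) / e) / s)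
      (df * (1 - (h r - c) / e) / s - f r * dh / e / s).
  move=> fd hd; apply: (is_derive_eq (is_derive1M (is_derive1M fd
    (is_derive1B (is_derive1C 1 r) (is_derive1M (is_derive1B hd
      (is_derive1C c r)) (is_derive1C e^-1 r)))) (is_derive1C s^-1 r))).
  by ring.
rewrite /smooth; apply: (is_derive_eq (is_derive1M
  (is_derive1M (is_derive1M dU dV) (is_derive1V r0 (is_derive1I r)))
  (is_derive1B (is_derive1B (is_derive1M dX dY) (half_derive _ _ _ _ _ _ dX dZ))
               (half_derive _ _ _ _ _ _ dY dW)))).
have p1 : p + 1 != 0 by rewrite gt_eqF // addr_gt0.
have q1 : q + 1 != 0 by rewrite gt_eqF // addr_gt0.
have e0 b1 : (if b1 then a else A) != 0 by case: b1; rewrite gt_eqF.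
(* The slope of each affine branch determines the dimension of its regime; this is how [m b] and
   [m b'] enter the derivative. *)
have mE b1 : m b1 = c / (if b1 then a else A) + 1.
  by case: b1; rewrite /regime //; field; rewrite gt_eqF.
by rewrite !mE; field; rewrite r0 p1 q1 !e0.
Qed.

Lemma psi_continuous r : 0 < r < rho -> {for r, continuous psi}.
Proof.
move=> rr; have [_ Xr _] := orbit_continuous H rr.
have [_ Yr _] := orbit_continuous H' rr.
have gZ := curv_orbit_continuous a0 A0 H rr.
have gW := curv_orbit_continuous a0 A0 H' rr.
apply: cvgB; first apply: cvgB; first by apply: cvgM; [exact: Xr|exact: Yr].
- apply: cvgM; last exact: cvg_cst.
  by apply: cvgM; [exact: Xr|apply: cvgB; [exact: cvg_cst|exact: gZ]].
- apply: cvgM; last exact: cvg_cst.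
  by apply: cvgM; [exact: Yr|apply: cvgB; [exact: cvg_cst|exact: gW]].
Qed.

Lemma energy_continuous r : 0 < r < rho -> {for r, continuous energy}.
Proof.
move=> rr; have [Ur _ _] := orbit_continuous H rr.
have [Vr _ _] := orbit_continuous H' rr.
apply: cvgM; last exact: psi_continuous.
apply: cvgM; first by apply: cvgM; [exact: Ur|exact: Vr].
by apply: cvgV; [case/andP: rr => r0 _; rewrite gt_eqF|exact: cvg_id].
Qed.

(** The factor [1 / r] is absorbed by [X / r] and [Y / r], which tend to 0. *)
Lemma energy_cvg0 : energy r @[r --> (0 : R)^'+] --> (0 : R).
Proof.
have [u0 U0] := orbit_U0 H; have [v0 V0] := orbit_U0 H'.
have gZ := curv_orbit_cvg0 a0 A0 H; have gW := curv_orbit_cvg0 a0 A0 H'.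
have : U r * V r * (X r / r * Y r - X r / r * (1 - g (Z r)) / (p + 1)
             - Y r / r * (1 - g (W r)) / (q + 1)) @[r --> (0 : R)^'+] -->
       u0 * v0 * (0 * 0 - 0 * (1 - 1) / (p + 1) - 0 * (1 - 1) / (q + 1)).
  apply: cvgM; first exact: cvgM.
  apply: cvgB; first apply: cvgB.
  - by apply: cvgM (orbit_X0 H) _; exact: (orbit_X_cvg0 H').
  - apply: cvgM; last exact: cvg_cst.
    by apply: cvgM (orbit_X0 H) _; apply: cvgB gZ; exact: cvg_cst.
  - apply: cvgM; last exact: cvg_cst.
    by apply: cvgM (orbit_X0 H') _; apply: cvgB gW; exact: cvg_cst.
rewrite !mul0r !subr0 mulr0; apply: cvg_trans; apply: near_eq_cvg.
by apply: nearW => r; rewrite /energy /psi; ring.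
Qed.

(** Where [energy] is negative it drops to the left, so a negative value at [s] would keep it below
    that value near 0, against its limit 0. The second bound concerns only points with a concave
    component: with both convex the two dimensions agree, and [pohozaev_gt0] asks for its bounds
    only when they differ. *)
Lemma energy_ge0 s : 0 < s < rho ->
  (forall r, 0 < r <= s -> 1 - g (W r) <= (q + 1) * X r) ->
  (forall r, 0 < r <= s -> c <= Z r \/ c <= W r -> 1 - g (Z r) <= (p + 1) * Y r) ->
  0 <= X s * Y s - X s * (1 - g (Z s)) / (p + 1) - Y s * (1 - g (W s)) / (q + 1).
Proof.
move=> /andP[s0 sr] DW DZ; rewrite -/(psi s) leNgt; apply/negP => psis.
have energy_sign r : 0 < r < rho -> energy r < 0 -> psi r < 0.
  move=> /andP[r0 rr]; rewrite pmulr_rlt0 // divr_gt0 // mulr_gt0 //.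
    by rewrite (orbit_U_gt0 H) // r0.
  by rewrite (orbit_U_gt0 H') // r0.
have Es : energy s < 0.
  rewrite pmulr_rlt0 // divr_gt0 // mulr_gt0 //.
    by rewrite (orbit_U_gt0 H) // s0.
  by rewrite (orbit_U_gt0 H') // s0.
have drop x : 0 < x <= s -> energy x < 0 ->
    \forall y \near x^'-, energy y < energy x.
  move=> /andP[x0 xs] Ex; have xr : 0 < x < rho by rewrite x0 (le_lt_trans xs).
  have psix := energy_sign x xr Ex.
  have sm b b' : in_regime a n b (Z x) -> in_regime a n b' (W x) ->
      \forall y \near x^'-, smooth b b' y < energy x.
    move=> bZ bW; rewrite (energy_smooth bZ bW).
    apply: derive_gt0_near_left (smooth_derive xr bZ bW) _.
    have U0 := orbit_U_gt0 H xr; have V0 := orbit_U_gt0 H' xr.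
    rewrite pmulr_rgt0 ?divr_gt0 ?exprn_gt0 ?mulr_gt0 //.
    apply: pohozaev_gt0 psix => //; try exact: regime_gt1.
    - exact: (orbit_X_gt0 H).
    - exact: (orbit_X_gt0 H').
    - move=> bb'; split; last by rewrite DW // x0.
      apply: DZ; first by rewrite x0.
      move: bZ bW bb'; case: b; case: b' => bZ bW bb';
        by [rewrite eqxx in bb'|left|right].
  have [_ _ Zx] := orbit_continuous H xr.
  have [_ _ Wx] := orbit_continuous H' xr.
  have regZ := in_regime_near a n Zx; have regW := in_regime_near a n Wx.
  (* Stated for all four pairs at once, because the pair that will be used is the one chosen at
     [y]. *)
  have smn : \forall y \near x^'-, forall b b', in_regime a n b (Z x) ->
      in_regime a n b' (W x) -> smooth b b' y < energy x.
    have T b b' : \forall y \near x^'-, in_regime a n b (Z x) ->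
        in_regime a n b' (W x) -> smooth b b' y < energy x.
      have [bZ|nbZ] := pselect (in_regime a n b (Z x)); last exact: nearW.
      have [bW|nbW] := pselect (in_regime a n b' (W x)); last exact: nearW.
      by apply: filterS (sm _ _ bZ bW).
    by near=> y; case; case; near: y; exact: T.
  near=> y; rewrite (@energy_smooth (c <= Z y) (c <= W y)).
  - have : forall b b', in_regime a n b (Z x) ->
      in_regime a n b' (W x) -> smooth b b' y < energy x by near: y; exact: smn.
    by apply; near: y.
  - by rewrite /in_regime; case: leP => // /ltW.
  - by rewrite /in_regime; case: leP => // /ltW.
have near0 : \forall y \near (0 : R)^'+, energy s < energy y.
  exact: cvgr_gt energy_cvg0 _ Es.
near (0 : R)^'+ => y.
have y0 : 0 < y by near: y; exact: nbhs_right_gt.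
have ys : y < s by near: y; exact: nbhs_right_lt.
have : energy y < energy s.
  apply: left_drop_lt => // [z /andP[yz zs]|x /andP[yx xs]].
    by apply: energy_continuous; rewrite (lt_le_trans y0) // (le_lt_trans zs).
  by apply: drop; rewrite xs (lt_trans y0).
by rewrite ltNge => /negP; apply; apply: ltW; near: y; exact: near0.
Unshelve. all: by end_near. Qed.

End Energy.
(** Lowering [Q] to [2 + Y] leaves an expression symmetric under exchange of [(X, p)] and [(Y, q)].
    Its opposite is a sum of nonnegative terms built on the larger of [X] and [Y], the cross term
    being controlled by [2 + X <= p * Y] or [2 + Y <= q * X]. *)
Lemma psi_lt0 (R : realFieldType) (p q n X Y Q : R) :
  0 < p -> 0 < q -> 1 < p * q -> 0 < X -> 0 < Y ->
  n - 2 <= n / (p + 1) + n / (q + 1) ->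
  2 + X < n -> 2 + Y <= Q -> Q < n -> 2 + X <= p * Y -> Q <= q * X ->
  X * Y - X * (2 + X) / (p + 1) - Y * Q / (q + 1) < 0.
Proof.
move=> p0 q0 pq1 X0 Y0 crit Xn YQ Qn XY QX.
have p10 : 0 < p + 1 by rewrite addr_gt0.
have q10 : 0 < q + 1 by rewrite addr_gt0.
pose k := n / (p + 1) + n / (q + 1) - (n - 2).
have k0 : 0 <= k by rewrite subr_ge0.
(* This is [1 - 1 / (p + 1) - 1 / (q + 1)], positive exactly because [p * q > 1]. *)
pose h := (p * q - 1) / ((p + 1) * (q + 1)).
have h0 : 0 < h by rewrite divr_gt0 ?mulr_gt0 // subr_gt0.
have step : X * Y - X * (2 + X) / (p + 1) - Y * Q / (q + 1) <=
    X * Y - X * (2 + X) / (p + 1) - Y * (2 + Y) / (q + 1).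
  by rewrite lerB // ler_pM2r ?invr_gt0 // ler_pM2l.
apply: le_lt_trans step _.
have [leXY|ltYX] := leP X Y.
- rewrite (_ : X * Y - X * (2 + X) / (p + 1) - Y * (2 + Y) / (q + 1) =
      - (k * Y + Y * h * (n - 2 - Y) + (Y - X) * (p * Y - (2 + X)) / (p + 1)));
    last by rewrite /k /h; field; rewrite !gt_eqF.
  rewrite oppr_lt0 ltr_wpDr //.
    by rewrite divr_ge0 ?mulr_ge0 ?subr_ge0 // ltW.
  rewrite ltr_wpDl ?mulr_ge0 ?(ltW Y0) // mulr_gt0 //; first exact: mulr_gt0.
  by rewrite subr_gt0; lra.
- rewrite (_ : X * Y - X * (2 + X) / (p + 1) - Y * (2 + Y) / (q + 1) =
      - (k * X + X * h * (n - 2 - X) + (X - Y) * (q * X - (2 + Y)) / (q + 1)));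
    last by rewrite /k /h; field; rewrite !gt_eqF.
  rewrite oppr_lt0 ltr_wpDr //.
    by rewrite divr_ge0 ?mulr_ge0 ?subr_ge0 ?(ltW ltYX) ?(ltW q10) // (le_trans YQ).
  rewrite ltr_wpDl ?mulr_ge0 ?(ltW X0) // mulr_gt0 //; first exact: mulr_gt0.
  by rewrite subr_gt0; lra.
Qed.

(** The last clause gives negative values arbitrarily close to [t], not a whole interval of them;
    [growth_stays_neg] supplies the interval. *)
Definition first_exit (R : realType) (f : R -> R) (rho t : R) : Prop :=
  [/\ 0 < t < rho, f t = 0, forall r, 0 < r <= t -> 0 <= f r &
     forall e, 0 < e -> exists2 r, t < r < t + e & r < rho /\ f r < 0].

(** * Excluding a point where [X] or [Y] stops increasing *)

Section Monotone.
Context {R : realType} {a A n rho : R}.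
Hypotheses (a0 : 0 < a) (A0 : 0 < A) (n1 : 1 < n) (rho0 : 0 < rho).
Local Notation g := (curv a A n).
Local Notation c := (a * (n - 1)).
Local Notation m := (regime a A n).
Implicit Types (p q : R) (U V X Y Z W : R -> R).

Lemma curv_lt0 z : g z < 0 -> z < c.
Proof.
rewrite !ltNge; apply: contra => cz.
by rewrite curv_concave // divr_ge0 ?subr_ge0 // ltW.
Qed.

(** In the convex regime [1 - g z] equals [m false - z / A]. *)
Lemma curv_gt_regime z : 0 < z -> g z < 0 -> 1 - g z < m false.
Proof.
move=> z0 /curv_lt0 /ltW zc; rewrite curv_convex // /regime.
rewrite -subr_gt0 (_ : _ - _ = z / A) ?divr_gt0 //.
by field; rewrite gt_eqF.
Qed.

Lemma growth_first_exit p U X Y Z r : half_orbit a A n p rho U X Z Y ->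
  0 < r < rho -> X r + 1 + g (Z r) < 0 ->
  exists t, first_exit (fun r => X r + 1 + g (Z r)) rho t.
Proof.
move=> H /andP[r0 rr] neg.
have /nbhs_ballP[e /= e0 pos] := growth_near0 a0 A0 rho0 H.
have pos' z : 0 < z < e -> 0 < X z + 1 + g (Z z).
  move=> /andP[z0 ze]; apply: pos => //.
  by rewrite /ball /= sub0r normrN gtr0_norm.
pose b := Num.min e r / 2.
have b0 : 0 < b by rewrite divr_gt0 // lt_min e0.
have bm : b < Num.min e r.
  by rewrite ltr_pdivrMr // mulr_natr mulr2n ltrDl lt_min e0.
have [be br] : b < e /\ b < r by move: bm; rewrite lt_min => /andP[].
have [|||t /andP[bt tr] [ft before after]] :=
    @first_neg R (fun r => X r + 1 + g (Z r)) b r br.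
- move=> z /andP[/(lt_le_trans b0) z0 /le_lt_trans/(_ rr) zr].
  by apply: (growth_continuous a0 A0 H); rewrite z0 zr.
- by apply: pos'; rewrite b0.
- exact: neg.
exists t; split=> // [|z /andP[z0 zt]|d d0].
- by rewrite (lt_trans b0) // (lt_trans tr).
- have [bz|zb] := leP b z; first by apply: before; rewrite bz.
  by apply: ltW; apply: pos'; rewrite z0 (lt_trans zb).
- have [z zt [zr fz]] := after d d0; exists z => //; split=> //.
  exact: le_lt_trans rr.
Qed.

(** At [s] one has [g (Z s) = - (1 + X s)] and [g (W s) <= - (1 + Y s)], so both components are
    convex there; the sign of [psi] given by [psi_lt0] then contradicts [energy_ge0]. *)
Lemma no_ordered_exits p q U V X Y Z W s t :
  half_orbit a A n p rho U X Z Y -> half_orbit a A n q rho V Y W X ->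
  0 < p -> 0 < q -> 1 < p * q ->
  (forall b b', Num.max (m b) (m b') - 2 <= m b / (p + 1) + m b' / (q + 1)) ->
  first_exit (fun r => X r + 1 + g (Z r)) rho s ->
  first_exit (fun r => Y r + 1 + g (W r)) rho t -> t <= s -> False.
Proof.
move=> H H' p0 q0 pq1 crit [/andP[s0 sr] Xs beforeX _].
move=> [/andP[t0 tr] Yt beforeY afterY] ts.
have inI r : 0 < r <= s -> 0 < r < rho.
  by move=> /andP[-> /le_lt_trans ->].
have ssr : 0 < s < rho by rewrite s0.
have mW r : 0 < r <= s -> 1 - g (W r) - q * X r <= 0.
  move=> rs; apply: (orbit_Z_decay a0 A0 H' H) => //; first exact: inI.
  move=> z /andP[z0 zr]; apply: beforeX; rewrite z0 (le_trans zr) //.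
  by case/andP: rs.
have mZt r : 0 < r <= t -> 1 - g (Z r) - p * Y r <= 0.
  move=> /andP[r0 rt]; apply: (orbit_Z_decay a0 A0 H H') => //.
    by rewrite r0 (le_lt_trans rt).
  move=> z /andP[z0 zr]; apply: beforeY; rewrite z0 (le_trans zr) //.
(* Negative values occur just after [t], and they persist up to [s] because [W] is nonincreasing on
   [(0, s]]. *)
have Yneg r : t < r <= s -> Y r + 1 + g (W r) < 0.
  move=> /andP[tr' rs].
  have [|z /andP[tz +] [zr Yz]] := afterY (r - t); first by rewrite subr_gt0.
  rewrite subrKC => /ltW z_r; have z0 := lt_trans t0 tz.
  apply: (growth_stays_neg a0 A0 H' z0) Yz; first by rewrite z_r (le_lt_trans rs).
  move=> y /andP[zy yr]; apply: mW.
  by rewrite (lt_le_trans z0) // (le_trans yr).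
have Ys : Y s + 1 + g (W s) <= 0.
  have [ts'|st] := ltP t s; first by rewrite ltW // Yneg // ts' lexx.
  by rewrite (_ : s = t) ?Yt //; apply/eqP; rewrite eq_le st.
have X0 := orbit_X_gt0 H ssr; have Y0 := orbit_X_gt0 H' ssr.
have Z0 := orbit_Z_gt0 H ssr; have W0 := orbit_Z_gt0 H' ssr.
(* Past [t], [Y] has stopped increasing and [orbit_Z_decay] no longer applies. But if [Z] were
   increasing at [s], then [X + 1 + g Z], which is 0 at [s], would be negative just before [s]. *)
have mZs : 1 - g (Z s) - p * Y s <= 0.
  have [ts'|st] := ltP t s; last by apply: mZt; rewrite s0.
  rewrite leNgt; apply/negP => mpos.
  have small : \forall y \near s^'-, Z y < Z s.
    apply: derive_gt0_near_left (orbit_dZ H ssr) _.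
    by rewrite divr_gt0 // mulr_gt0.
  near s^'- => y.
  have y0 : 0 < y by near: y; exact: nbhs_left_gt.
  have ys : y <= s by near: y; exact: nbhs_left_le.
  have Xys : X y <= X s.
    apply: (orbit_X_ndecr H y0); first by rewrite ys.
    move=> z /andP[yz zs]; apply: beforeX.
    by rewrite (lt_trans y0) // ltW.
  have Zys : Z y < Z s by near: y; exact: small.
  have : X y + 1 + g (Z y) < X s + 1 + g (Z s).
    apply: ler_ltD; first by rewrite lerD2r.
    by rewrite (leW_mono (curv_mono a0 A0)).
  by rewrite Xs ltNge beforeX // y0.
have gZs : g (Z s) = - (1 + X s) by move: Xs; lra.
have gWs : g (W s) <= - (1 + Y s) by move: Ys; lra.
have : 0 <= X s * Y s - X s * (1 - g (Z s)) / (p + 1) - Y s * (1 - g (W s)) / (q + 1).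
  apply: (energy_ge0 a0 A0 n1 p0 q0 H H' crit ssr) => r rs.
    have /andP[r0 rs'] := inI r rs.
    have := mW r rs; have := orbit_X_gt0 H (inI r rs); lra.
  have Yr := orbit_X_gt0 H' (inI r rs).
  case/andP: (rs) => r0 rs'.
  have [rt|tr'] := leP r t.
    by move=> _; have := mZt r; rewrite r0 rt => /(_ isT); lra.
  have gW : g (W r) < 0 by have := Yneg r; rewrite tr' rs' => /(_ isT); lra.
  (* After [t] only [Z] can be concave, and then [1 - g (Z r) <= 1 < 2 + X s <= p * Y s <= p * Y r],
     as [Y] is nonincreasing there. *)
  case; last by rewrite leNgt (curv_lt0 gW).
  move=> cZ; have gZ : 0 <= g (Z r).
    by rewrite curv_concave // divr_ge0 ?subr_ge0 // ltW.
  have Yrs : Y s <= Y r.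
    apply: (orbit_X_nincr H' r0); first by rewrite rs'.
    move=> z /andP[rz zs]; apply: ltW; apply: Yneg.
    by rewrite (lt_trans tr') // ltW.
  have : p * Y s <= p * Y r by rewrite ler_pM2l.
  by move: mZs; lra.
apply/negP; rewrite -ltNge (_ : 1 - g (Z s) = 2 + X s); last by rewrite gZs; ring.
have XN := curv_gt_regime Z0; have YN := curv_gt_regime W0.
apply: (@psi_lt0 _ p q (m false)) => //.
- by have := crit false false; rewrite max_l.
- by have := XN _; rewrite gZs; lra.
- by lra.
- by apply: YN; lra.
- by move: mZs; lra.
- by have := mW s; rewrite s0 lexx => /(_ isT); lra.
Unshelve. all: by end_near. Qed.

(** If [X] stops increasing, so does [Y] by [growth_ge0_of_partner]. The two first exits come in
    some order, and exchanging the equations reduces either order to [no_ordered_exits]. *)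
Lemma growth_ge0 p q U V X Y Z W :
  half_orbit a A n p rho U X Z Y -> half_orbit a A n q rho V Y W X ->
  0 < p -> 0 < q -> 1 < p * q ->
  (forall b b', Num.max (m b) (m b') - 2 <= m b / (p + 1) + m b' / (q + 1)) ->
  forall r, 0 < r < rho -> 0 <= X r + 1 + g (Z r).
Proof.
move=> H H' p0 q0 pq1 crit r rr; rewrite leNgt; apply/negP => Xr.
have [s Es] := growth_first_exit H rr Xr.
have [Yge|/existsNP[y /not_implyP[yr /negP]]] :=
    pselect (forall y, 0 < y < rho -> 0 <= Y y + 1 + g (W y)).
  have := growth_ge0_of_partner a0 A0 rho0 H H' p0 Yge rr.
  by rewrite leNgt Xr.
rewrite -ltNge => Yy; have [t Et] := growth_first_exit H' yr Yy.
have [ts|/ltW st] := leP t s.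
  exact: (no_ordered_exits H H' p0 q0 pq1 crit Es Et ts).
apply: (no_ordered_exits H' H q0 p0 _ _ Et Es st); first by rewrite mulrC.
by move=> b b'; rewrite maxC [leRHS]addrC.
Qed.

End Monotone.

(** * From the radial equations to the orbits *)

Definition pucci1 (R : realType) (a A t : R) : R :=
  A * Num.max t 0 + a * Num.min t 0.

(* U1 and U2 stand for U' and U''. *)
Record profile (R : realType) (a A n p rho : R) (U U1 U2 V : R -> R) : Prop :=
  Profile {
    profile_gt0 : forall r, 0 < r < rho -> 0 < U r;
    profile_dU : forall r, 0 < r < rho -> is_derive r 1 U (U1 r);
    profile_dU1 : forall r, 0 < r < rho -> is_derive r 1 U1 (U2 r);
    profile_eq : forall r, 0 < r < rho ->
      pucci1 a A (U2 r) + (n - 1) * pucci1 a A (U1 r / r) + V r `^ p = 0;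
    profile_U0 : exists2 u0 : R, 0 < u0 & U r @[r --> (0 : R)^'+] --> u0;
    profile_h : exists2 h : R, U1 r / r @[r --> (0 : R)^'+] --> h
                               & U2 r @[r --> (0 : R)^'+] --> h;
    profile_Urho : U r @[r --> rho^'-] --> (0 : R) }.

Section Pucci1.
Context {R : realType} {a A : R}.
Hypotheses (a0 : 0 < a) (A0 : 0 < A).

Lemma pucci1_ge t : 0 <= t -> pucci1 a A t = A * t.
Proof. by move=> t0; rewrite /pucci1 max_l // min_r // mulr0 addr0. Qed.

Lemma pucci1_le t : t <= 0 -> pucci1 a A t = a * t.
Proof. by move=> t0; rewrite /pucci1 max_r // min_l // mulr0 add0r. Qed.

Lemma pucci1_ge0 t : (0 <= pucci1 a A t) = (0 <= t).
Proof.
have [t0|t0] := leP 0 t; first by rewrite pucci1_ge // mulr_ge0 // ltW.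
by apply/negbTE; rewrite -ltNge pucci1_le ?(ltW t0) // pmulr_rlt0.
Qed.

Lemma pucci1_le0 t : (pucci1 a A t <= 0) = (t <= 0).
Proof.
have [t0|t0] := leP t 0.
  by rewrite pucci1_le // pmulr_rle0.
by apply/negbTE; rewrite -ltNge pucci1_ge ?(ltW t0) // mulr_gt0.
Qed.

Lemma continuous_pucci1 : continuous (pucci1 a A).
Proof.
have gE : pucci1 a A = fun z => z * ((A + a) / 2) + `|z| * ((A - a) / 2).
  apply/funext => z; have [z0|/ltW z0] := leP 0 z.
    by rewrite pucci1_ge // ger0_norm //; field.
  by rewrite pucci1_le // ler0_norm //; field.
rewrite gE => z.
apply: cvgD; apply: cvgM; try exact: cvg_cst; first exact: cvg_id.
by apply: cvg_norm; exact: cvg_id.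
Qed.

End Pucci1.

Lemma powR_cvg (R : realType) (T : Type) (F : set_system T) (FF : Filter F)
    (f : T -> R) (x p : R) : 0 < x ->
  f t @[t --> F] --> x -> f t `^ p @[t --> F] --> x `^ p.
Proof.
move=> x0; apply: (@continuous_cvg _ _ _ F FF f (fun y => y `^ p) x).
exact: is_derive1_continuous (is_derive1_powR p x0).
Qed.

Section Profiles.
Context {R : realType} {a A n rho p q : R} {U U1 U2 V V1 V2 : R -> R}.
Hypotheses (a0 : 0 < a) (A0 : 0 < A) (n1 : 1 < n) (rho0 : 0 < rho).
Hypothesis p0 : 0 < p.
Hypothesis H : profile a A n p rho U U1 U2 V.
Hypothesis H' : profile a A n q rho V V1 V2 U.
Local Notation g := (curv a A n).
Local Notation c := (a * (n - 1)).

(** The equation passes to the limit at the origin, where [U''] and [U' / r] share the limit [h]; a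
    nonnegative [h] would make its left side positive. *)
Lemma profile_h_lt0 (h v0 : R) : 0 < v0 ->
  V r @[r --> (0 : R)^'+] --> v0 -> U1 r / r @[r --> (0 : R)^'+] --> h ->
  U2 r @[r --> (0 : R)^'+] --> h -> h < 0 /\ a * n * h = - v0 `^ p.
Proof.
move=> v00 V0 Uh1 Uh2.
have E : pucci1 a A (U2 r) + (n - 1) * pucci1 a A (U1 r / r) + V r `^ p
    @[r --> (0 : R)^'+] --> pucci1 a A h + (n - 1) * pucci1 a A h + v0 `^ p.
  apply: cvgD; last exact: powR_cvg.
  apply: cvgD.
    by apply: continuous_cvg Uh2; exact: continuous_pucci1.
  apply: cvgM; first exact: cvg_cst.
  by apply: continuous_cvg Uh1; exact: continuous_pucci1.
have E0 : pucci1 a A h + (n - 1) * pucci1 a A h + v0 `^ p = 0.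
  apply: (cvg_unique _ E) => //; apply: cvg_near_cst.
  near=> r; apply: (profile_eq H); apply/andP; split; near: r.
    exact: nbhs_right_gt.
  exact: nbhs_right_lt.
have vp : 0 < v0 `^ p by rewrite powR_gt0.
have h0 : h < 0.
  rewrite ltNge -(pucci1_ge0 a0 A0); apply/negP => ph.
  have : 0 < pucci1 a A h + (n - 1) * pucci1 a A h + v0 `^ p.
    by rewrite ltr_wpDl // addr_ge0 // mulr_ge0 // subr_ge0 ltW.
  by rewrite E0 ltxx.
split=> //; move: E0; rewrite pucci1_le ?(ltW h0) //; lra.
Unshelve. all: by end_near. Qed.

(** [U1] is negative near 0. At a first point where it is nonnegative the equation forces [U2 < 0],
    so [U1] would be positive just before. *)
Lemma profile_U1_lt0 r : 0 < r < rho -> U1 r < 0.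
Proof.
move=> /andP[r0 rr]; rewrite ltNge; apply/negP => U1r.
have [v0 v00 V0] := profile_U0 H'; have [h Uh1 Uh2] := profile_h H.
have [h0 _] := profile_h_lt0 v00 V0 Uh1 Uh2.
have small : \forall r \near (0 : R)^'+, U1 r / r < 0.
  exact: cvgr_lt Uh1 _ h0.
near (0 : R)^'+ => b.
have b0 : 0 < b by near: b; exact: nbhs_right_gt.
have br : b < r by near: b; exact: nbhs_right_lt.
have U1b : U1 b < 0.
  by rewrite -(pmulr_llt0 _ (_ : 0 < b^-1)) ?invr_gt0 //; near: b; exact: small.
have inI z : b <= z <= r -> 0 < z < rho.
  by move=> /andP[/(lt_le_trans b0) -> /le_lt_trans ->].
have [||||t /andP[bt tr] [U1t before]] := @first_nonpos R (fun r => - U1 r) b r.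
- exact: br.
- move=> z /inI zr; apply: cvgN; exact: is_derive1_continuous (profile_dU1 H zr).
- by rewrite oppr_gt0.
- by rewrite oppr_le0.
have trho : 0 < t < rho by rewrite inI // tr (ltW bt).
case/andP: (trho) => t0 _.
have {}U1t : 0 <= U1 t by rewrite -oppr_le0.
have U2t : U2 t < 0.
  rewrite ltNge -(pucci1_ge0 a0 A0); apply/negP => pU2.
  have : 0 < pucci1 a A (U2 t) + (n - 1) * pucci1 a A (U1 t / t) + V t `^ p.
    rewrite ltr_wpDl ?powR_gt0 ?(profile_gt0 H') // addr_ge0 // mulr_ge0 //.
      by rewrite subr_ge0 ltW.
    by rewrite pucci1_ge0 // divr_ge0 // ltW.
  by rewrite (profile_eq H) // ltxx.
have left : \forall y \near t^'-, - U1 y < - U1 t.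
  apply: derive_gt0_near_left (is_derive1N (profile_dU1 H trho)) _.
  by rewrite oppr_gt0.
near t^'- => y.
have : 0 < - U1 y.
  by apply: before; apply/andP; split; near: y; [exact: nbhs_left_ge|exact: nbhs_left_lt].
apply/negP; rewrite -leNgt; apply: (@le_trans _ _ (- U1 t)).
  by apply: ltW; near: y; exact: left.
by rewrite oppr_le0.
Unshelve. all: by end_near. Qed.

Let X r := - (r * U1 r / U r).
Let Z r := - (r * V r `^ p / U1 r).
Let Y r := - (r * V1 r / V r).

(** As [U1 < 0], the equation reads [pucci1 a A (U2 r) = (U1 r / r) * (Z r - c)], and the sign of
    [Z r - c] selects the branch of both [pucci1] and [g]. *)
Lemma profile_curvature r : 0 < r < rho -> U2 r = g (Z r) * (U1 r / r).
Proof.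
move=> rr; have U1r := profile_U1_lt0 rr; case/andP: (rr) => r0 _.
have U1r' : U1 r / r < 0 by rewrite pmulr_llt0 // invr_gt0.
have : pucci1 a A (U2 r) = (U1 r / r) * (Z r - c).
  have := profile_eq H rr; rewrite (pucci1_le (ltW U1r')) => E.
  have -> : pucci1 a A (U2 r) = - V r `^ p - (n - 1) * (a * (U1 r / r)).
    by move: E; lra.
  have r0' : r != 0 by rewrite gt_eqF.
  have U10 : U1 r != 0 by rewrite lt_eqF.
  by rewrite /Z; field; rewrite r0' U10.
have [cZ|/ltW Zc] := leP c (Z r) => E.
- have U2r : U2 r <= 0.
    by rewrite -(pucci1_le0 a0 A0) E nmulr_rle0 // subr_ge0.
  rewrite curv_concave // mulrAC [_ * (U1 r / r)]mulrC -E pucci1_le //.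
  by field; rewrite gt_eqF.
- have U2r : 0 <= U2 r.
    by rewrite -(pucci1_ge0 a0 A0) E nmulr_rge0 // subr_le0.
  rewrite curv_convex // mulrAC [_ * (U1 r / r)]mulrC -E pucci1_ge //.
  by field; rewrite gt_eqF.
Qed.

Lemma profile_half_orbit : half_orbit a A n p rho U X Z Y.
Proof.
have Ur r := profile_gt0 H (r := r); have Vr r := profile_gt0 H' (r := r).
split.
- by [].
- move=> r rr; case/andP: (rr) => r0 _.
  by rewrite oppr_gt0 pmulr_llt0 ?invr_gt0 ?Ur // pmulr_rlt0 // profile_U1_lt0.
- move=> r rr; case/andP: (rr) => r0 _.
  rewrite oppr_gt0 pmulr_rlt0 ?invr_lt0 ?profile_U1_lt0 //.
  by rewrite mulr_gt0 // powR_gt0 // Vr.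
- move=> r rr; apply: (is_derive_eq (profile_dU H rr)).
  have r0 : r != 0 by case/andP: rr => r0 _; rewrite gt_eqF.
  have U0 : U r != 0 by rewrite gt_eqF // Ur.
  by rewrite /X; field; rewrite r0 U0.
- move=> r rr; have U0 : U r != 0 by rewrite gt_eqF // Ur.
  have r0 : r != 0 by case/andP: rr => r0 _; rewrite gt_eqF.
  apply: (is_derive_eq (is_derive1N (is_derive1M (is_derive1M (is_derive1I r)
    (profile_dU1 H rr)) (is_derive1V U0 (profile_dU H rr))))).
  by rewrite profile_curvature // /X; field; rewrite U0 r0.
- move=> r rr; have U10 : U1 r != 0 by rewrite lt_eqF // profile_U1_lt0.
  have r0 : r != 0 by case/andP: rr => r0 _; rewrite gt_eqF.
  have V0 : V r != 0 by rewrite gt_eqF // Vr.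
  have dVp := is_derive1_comp (is_derive1_powR p (Vr r rr)) (profile_dU H' rr).
  apply: (is_derive_eq (is_derive1N (is_derive1M (is_derive1M (is_derive1I r)
    dVp) (is_derive1V U10 (profile_dU1 H rr))))).
  (* Removes the exponent [p - 1], so that [field] sees a single power of [V r]. *)
  have -> : V r `^ (p - 1) = V r `^ p / V r.
    by rewrite -(mulr_powRB1 (ltW (Vr r rr)) p0); field.
  by rewrite profile_curvature // /Z /Y /=; field; rewrite U10 r0 V0.
- by have [u0 _ U0] := profile_U0 H; exists u0.
- have [u0 u00 U0] := profile_U0 H; have [h Uh1 _] := profile_h H.
  have : - (U1 r / r * r / U r) @[r --> (0 : R)^'+] --> - (h * 0 / u0).
    apply: cvgN; apply: cvgM; last by apply: cvgV => //; rewrite gt_eqF.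
    by apply: cvgM Uh1 _; apply: cvg_at_right_filter; exact: cvg_id.
  rewrite mulr0 mul0r oppr0; apply: cvg_trans; apply: near_eq_cvg.
  near=> r; have r0 : 0 < r by near: r; exact: nbhs_right_gt.
  have r0' : r != 0 by rewrite gt_eqF.
  have U0r : U r != 0.
    by rewrite gt_eqF // Ur // r0; near: r; exact: nbhs_right_lt.
  by rewrite /X; field; rewrite r0' U0r.
- have [v0 v00 V0] := profile_U0 H'; have [h Uh1 Uh2] := profile_h H.
  have [h0 hE] := profile_h_lt0 v00 V0 Uh1 Uh2.
  have -> : a * n = - (v0 `^ p / h).
    by rewrite -mulNr -hE mulfK // lt_eqF.
  have : - (V r `^ p / (U1 r / r)) @[r --> (0 : R)^'+] --> - (v0 `^ p / h).
    apply: cvgN; apply: cvgM; first exact: powR_cvg.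
    by apply: cvgV => //; rewrite lt_eqF.
  apply: cvg_trans; apply: near_eq_cvg.
  near=> r; have r0 : 0 < r by near: r; exact: nbhs_right_gt.
  have r0' : r != 0 by rewrite gt_eqF.
  have U10 : U1 r != 0.
    by rewrite lt_eqF // profile_U1_lt0 // r0; near: r; exact: nbhs_right_lt.
  by rewrite /Z; field; rewrite r0' U10.
- exact: profile_Urho H.
Unshelve. all: by end_near. Qed.

(** If [U] were concave throughout, [U1] would stay below a negative constant near [rho], while [V]
    tends to 0; hence [Z] would tend to 0, below [c > 0]. *)
Lemma profile_convex_somewhere : exists2 r, 0 < r < rho & Z r < c.
Proof.
apply/not_exists2P => noconvex.
have concave r : 0 < r < rho -> c <= Z r.
  by move=> rr; case: (noconvex r) => // /negP; rewrite -leNgt.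
pose r1 := rho / 2.
have r10 : 0 < r1 by rewrite divr_gt0.
have r1r : r1 < rho by rewrite ltr_pdivrMr // mulr_natr mulr2n ltrDl.
have inI z : r1 <= z < rho -> 0 < z < rho.
  by move=> /andP[/(lt_le_trans r10) -> ->].
have U1b r : r1 <= r < rho -> U1 r <= U1 r1.
  move=> /andP[r1r' rr]; apply: (@derive_le0_ge R _ U2) r1r' _ _ => z zr.
    apply: (profile_dU1 H); case/andP: zr => r1z zr.
    by rewrite inI // r1z (le_lt_trans zr).
  have zr' : 0 < z < rho.
    by case/andP: zr => r1z zr; rewrite inI // (ltW r1z) (lt_trans zr).
  have z0 : 0 < z by case/andP: zr'.
  rewrite profile_curvature // mulr_ge0_le0 //.
    by rewrite curv_concave ?concave // divr_ge0 ?(ltW a0) // subr_ge0 concave.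
  by rewrite ltW // pmulr_llt0 ?invr_gt0 // profile_U1_lt0.
have U1r1 : U1 r1 < 0 by apply: profile_U1_lt0; rewrite r10 r1r.
have c0 : 0 < c by rewrite mulr_gt0 // subr_gt0.
(* Chosen so that [V r ^ p < d] gives [Z r < rho * d / (- U1 r1) = c]. *)
pose d := c * - U1 r1 / rho.
have d0 : 0 < d by rewrite divr_gt0 // mulr_gt0 // oppr_gt0.
have Vsmall : \forall r \near rho^'-, V r `^ p < d.
  have d'0 : 0 < d `^ p^-1 by rewrite powR_gt0.
  have : \forall r \near rho^'-, V r < d `^ p^-1.
    exact: cvgr_lt (profile_Urho H') _ d'0.
  move=> small; near=> r.
  have V0 : 0 < V r.
    apply: (profile_gt0 H'); apply/andP; split; near: r.
      exact: nbhs_left_gt.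
    exact: nbhs_left_lt.
  have : V r `^ p < (d `^ p^-1) `^ p.
    by rewrite gt0_ltr_powR ?nnegrE ?(ltW V0) ?powR_ge0 //; near: r; exact: small.
  by rewrite -powRrM mulVf ?gt_eqF // powRr1 // ltW.
near rho^'- => r.
have r1r' : r1 <= r by near: r; exact: nbhs_left_ge.
have rr : r < rho by near: r; exact: nbhs_left_lt.
have rI : 0 < r < rho by rewrite inI // r1r' rr.
have U1r : U1 r < 0 by exact: profile_U1_lt0.
have := concave r rI; rewrite leNgt => /negP; apply.
have Vd : V r `^ p < d by near: r; exact: Vsmall.
rewrite /Z -mulrN -invrN ltr_pdivrMr ?oppr_gt0 //.
case/andP: rI => r0 _.
apply: (@lt_le_trans _ _ (r * d)); first by rewrite ltr_pM2l.
apply: (@le_trans _ _ (rho * d)); first by rewrite ler_pM2r // ltW.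
rewrite /d mulrC divfK ?gt_eqF // ler_pM2l // lerN2 U1b //.
by rewrite r1r'.
Unshelve. all: by end_near. Qed.

(** [Z] is nonincreasing, starts near [a * n > c] and ends below [c], while [U2] has the sign
    opposite to that of [g Z]. *)
Lemma profile_concavity :
  (forall r, 0 < r < rho -> 1 - g (Z r) - p * Y r <= 0) ->
  changes_concavity_once rho U.
Proof.
move=> decay.
have HO := profile_half_orbit.
have Zdecr x y : 0 < x -> x <= y < rho -> Z y <= Z x.
  move=> x0 /andP[xy yr]; apply: (orbit_Z_nincr HO x0); first by rewrite xy.
  by move=> z /andP[xz zy]; rewrite decay // (lt_trans x0) // (lt_trans zy).
have [y /andP[y0 yr] Zy] := profile_convex_somewhere.
have start : \forall r \near (0 : R)^'+, c < Z r.
  by apply: cvgr_gt (orbit_Z0 HO) _ _; rewrite ltr_pM2l // gtrBl.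
near (0 : R)^'+ => b.
have b0 : 0 < b by near: b; exact: nbhs_right_gt.
have b_y : b < y by near: b; exact: nbhs_right_lt.
have Zb : c < Z b by near: b; exact: start.
have [|||t /andP[bt ty] [Zt before after]] := @first_neg R (fun r => Z r - c) b y b_y.
- move=> z /andP[/(lt_le_trans b0) z0 /le_lt_trans/(_ yr) zr].
  apply: cvgB; last exact: cvg_cst.
  by have [|] := orbit_continuous HO (r := z); first by rewrite z0.
- by rewrite subr_gt0.
- by rewrite subr_lt0.
have t0 := lt_trans b0 bt; have tr := lt_trans ty yr.
(* [U] is differentiated as a function on the whole line and its derivative is known only inside
   [(0, rho)], hence the local comparison. *)
have U2E r : 0 < r < rho -> (U^`(2))%classic r = U2 r.
  move=> rr; rewrite derive1nS derive1n1 derive1E.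
  have := profile_dU1 H rr => /near_eq_is_derive -/(_ (U^`())%classic) dU1.
  apply: derive_val; apply: dU1.
  case/andP: rr => r0 rr; near=> z.
  have dU : is_derive z 1 U (U1 z).
    apply: (profile_dU H).
    by apply/andP; split; near: z; [exact: lt_nbhsr|exact: lt_nbhsl].
  by rewrite derive1E derive_val.
have sgn r : 0 < r < rho -> exists2 k, 0 < k & U2 r = - (k * g (Z r)).
  move=> rr; exists (- (U1 r / r)).
    by rewrite oppr_gt0 pmulr_llt0 ?profile_U1_lt0 // invr_gt0; case/andP: rr.
  by rewrite profile_curvature // mulNr opprK mulrC.
have concave r : 0 < r < rho -> c <= Z r -> U2 r <= 0.
  move=> rr cZ; have [k k0 ->] := sgn r rr.
  by rewrite oppr_le0 mulr_ge0 ?(ltW k0) // curv_concave // divr_ge0 ?subr_ge0 // ltW.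
have convex r : 0 < r < rho -> Z r < c -> 0 < U2 r.
  move=> rr Zc; have [k k0 ->] := sgn r rr.
  by rewrite oppr_gt0 pmulr_rlt0 // curv_convex ?(ltW Zc) // pmulr_llt0 ?invr_gt0 // subr_lt0.
exists t, 1; split; [by rewrite t0 tr|by left|split|split].
- move=> r /andP[r0 rt]; rewrite mul1r U2E ?concave ?r0 ?(lt_trans rt) //.
  have := Zdecr r t r0; rewrite (ltW rt) tr => /(_ isT).
  by move: Zt => /= /eqP; rewrite subr_eq0 => /eqP ->.
- exists b; first by rewrite b0.
  have bI : 0 < b < rho by rewrite b0 (lt_trans bt).
  rewrite mul1r U2E //; have [k k0 ->] := sgn b bI.
  by rewrite oppr_lt0 mulr_gt0 // curv_concave ?(ltW Zb) // divr_gt0 // subr_gt0.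
(* Points with [Z < c] accumulate at [t] from the right, and [Z] is nonincreasing. *)
- move=> r /andP[tr' rr]; rewrite mul1r U2E ?(lt_trans t0) //.
  have [|z /andP[tz zr] [zy /= Zz]] := after (r - t); first by rewrite subr_gt0.
  move: zr; rewrite subrKC => zr.
  apply: ltW; apply: convex; first by rewrite (lt_trans t0).
  apply: le_lt_trans (_ : Z z < c); last by rewrite -subr_lt0.
  by apply: Zdecr; [exact: lt_trans tz|rewrite (ltW zr)].
- by exists y; [rewrite ty|rewrite mul1r U2E ?convex // y0].
Unshelve. all: by end_near. Qed.

End Profiles.

(** * Gradient and Hessian of a radial function on an axis *)

Section Radial.
Context {R : realType} {n : nat} {rho : R}.
Context {u : 'rV[R]_n.+1 -> R} {U : R -> R}.
Hypothesis rho0 : 0 < rho.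
Hypothesis u_C2 : C2_on (eball rho) u.
Hypothesis uU : radial_profile rho u U.

Local Notation axis := (delta_mx 0 0 : 'rV[R]_n.+1).
Local Notation U1 := (fun r : R => partial ord0 u (r *: axis)).
Local Notation U2 := (fun r : R => partial ord0 (partial ord0 u) (r *: axis)).

Lemma derive_quotient_line (f : 'rV[R]_n.+1 -> R) y v (s : R) :
  (fun h : R => h^-1 *: ((f \o shift (y + s *: v)) (h *: v) - f (y + s *: v))) =
  (fun h : R => h^-1 *: (((fun t => f (y + t *: v)) \o shift s) (h *: 1)
                         - f (y + s *: v))).
Proof.
apply/funext => h /=; congr (_ *: (f _ - _)).
by rewrite [h *: 1]mulr1 scalerDl addrCA.
Qed.

(** Reduces directional derivatives to derivatives in one real variable, where the chain rule is
    applied. *)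
Lemma is_derive_line (f : 'rV[R]_n.+1 -> R) y v (s d : R) :
  is_derive (y + s *: v) v f d <-> is_derive s 1 (fun t => f (y + t *: v)) d.
Proof.
by split=> -[fd fE]; split; move: fd fE;
  rewrite /derivable /derive derive_quotient_line.
Qed.

Lemma enorm_ge0 (x : 'rV[R]_n.+1) : 0 <= enorm x.
Proof. exact: sqrtr_ge0. Qed.

Lemma sqr_enorm (x : 'rV[R]_n.+1) : enorm x ^+ 2 = \sum_(i < n.+1) x 0 i ^+ 2.
Proof. by rewrite sqr_sqrtr // sumr_ge0 // => i _; exact: sqr_ge0. Qed.

Lemma sqr_enorm_line (x : 'rV[R]_n.+1) i (t : R) :
  enorm (x + t *: delta_mx 0 i) ^+ 2 = enorm x ^+ 2 + 2 * t * x 0 i + t ^+ 2.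
Proof.
rewrite !sqr_enorm (bigD1 i) //= [in RHS](bigD1 i) //= !mxE !eqxx /= mulr1.
rewrite (eq_bigr (fun k => x 0 k ^+ 2)); first by ring.
by move=> k /negbTE ki; rewrite !mxE ki andbF mulr0 addr0.
Qed.

Lemma enorm_line (x : 'rV[R]_n.+1) i (t : R) :
  enorm (x + t *: delta_mx 0 i) = Num.sqrt (enorm x ^+ 2 + 2 * t * x 0 i + t ^+ 2).
Proof. by rewrite -sqr_enorm_line sqrtr_sqr ger0_norm // enorm_ge0. Qed.

Lemma enorm0 : enorm (0 : 'rV[R]_n.+1) = 0.
Proof.
by rewrite /enorm big1 ?sqrtr0 // => i _; rewrite mxE expr0n.
Qed.

Lemma enorm_axis r : 0 <= r -> enorm (r *: axis) = r.
Proof.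
move=> r0; rewrite -[_ *: _]add0r enorm_line enorm0 mxE.
by rewrite expr0n /= mulr0 !add0r sqrtr_sqr ger0_norm.
Qed.

Lemma enorm_axisN r : enorm (- r *: axis) = enorm (r *: axis).
Proof.
rewrite -[_ *: _]add0r -[r *: _]add0r !enorm_line enorm0 mxE.
by rewrite !mulr0 sqrrN.
Qed.

Lemma is_derive_sqnorm_line (k l t : R) :
  is_derive t 1 (fun t : R => k + 2 * t * l + t ^+ 2) (2 * l + 2 * t).
Proof.
apply: (is_derive_eq (is_derive1D (is_derive1D (is_derive1C k t)
  (is_derive1M (is_derive1M (is_derive1C 2 t) (is_derive1I t)) (is_derive1C l t)))
  (is_derive1X 2 (is_derive1I t)))).
by rewrite /=; ring.
Qed.

Lemma line_in_ball (x : 'rV[R]_n.+1) i : enorm x < rho ->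
  \forall t \near (0 : R), enorm (x + t *: delta_mx 0 i) < rho.
Proof.
move=> xr.
have Q := is_derive1_continuous (is_derive_sqnorm_line (enorm x ^+ 2) (x 0 i) 0).
have : \forall t \near (0 : R), enorm x ^+ 2 + 2 * t * x 0 i + t ^+ 2 < rho ^+ 2.
  apply: cvgr_lt Q _ _; rewrite mulr0 mul0r expr0n /= !addr0.
  by rewrite ltrXn2r // ?nnegrE ?enorm_ge0 // ltW.
apply: filterS => t; rewrite -sqr_enorm_line.
by rewrite ltr_sqr ?nnegrE ?enorm_ge0 // ltW.
Qed.

Lemma line_nonzero (x : 'rV[R]_n.+1) i : 0 < enorm x ->
  \forall t \near (0 : R), 0 < enorm (x + t *: delta_mx 0 i).
Proof.
move=> x0.
have Q := is_derive1_continuous (is_derive_sqnorm_line (enorm x ^+ 2) (x 0 i) 0).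
have : \forall t \near (0 : R), 0 < enorm x ^+ 2 + 2 * t * x 0 i + t ^+ 2.
  apply: cvgr_gt Q _ _; rewrite mulr0 mul0r expr0n /= !addr0.
  by rewrite exprn_gt0.
by apply: filterS => t; rewrite enorm_line sqrtr_gt0.
Qed.

Lemma is_derive_norm_line (x : 'rV[R]_n.+1) i : 0 < enorm x ->
  is_derive (0 : R) 1 (fun t : R => enorm (x + t *: delta_mx 0 i)) (x 0 i / enorm x).
Proof.
move=> x0; rewrite (_ : (fun _ => _) = Num.sqrt \o
    (fun t : R => enorm x ^+ 2 + 2 * t * x 0 i + t ^+ 2)); last first.
  by apply/funext => t; rewrite enorm_line.
have Q := is_derive_sqnorm_line (enorm x ^+ 2) (x 0 i) 0.
have E : enorm x ^+ 2 + 2 * 0 * x 0 i + 0 ^+ 2 = enorm x ^+ 2.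
  by rewrite mulr0 mul0r expr0n /= !addr0.
apply: is_derive_eq.
  by apply: is_derive1_comp Q; apply: is_derive1_sqrt; rewrite E exprn_gt0.
rewrite /= E sqrtr_sqr ger0_norm ?enorm_ge0 // mulr0 addr0.
by field; rewrite gt_eqF.
Qed.

Lemma axis_in_ball r : 0 <= r < rho -> eball rho (r *: axis).
Proof. by move=> /andP[r0 rr]; rewrite /eball /= enorm_axis. Qed.

Lemma radial_dU r : 0 < r < rho -> is_derive r 1 U (U1 r).
Proof.
move=> /andP[r0 rr].
have [_ /(_ ord0)[du _] _] := u_C2 (axis_in_ball (introT andP (conj (ltW r0) rr))).
have : is_derive r 1 (fun t : R => u (0 + t *: axis)) (U1 r).
  by apply/is_derive_line; rewrite add0r; split.
apply: near_eq_is_derive; near=> t.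
have t0 : 0 < t by near: t; exact: lt_nbhsr.
have tr : t < rho by near: t; exact: lt_nbhsl.
by rewrite add0r uU /ecball /= enorm_axis ?ltW.
Unshelve. all: by end_near. Qed.

Lemma radial_dU1 r : 0 <= r < rho -> is_derive r 1 U1 (U2 r).
Proof.
move=> /axis_in_ball /u_C2[_ _ /(_ ord0 ord0)[du _]].
have : is_derive r 1 (fun t : R => partial ord0 u (0 + t *: axis)) (U2 r).
  by apply/is_derive_line; rewrite add0r; split.
by congr is_derive; apply/funext => t; rewrite add0r.
Qed.

Lemma radial_partial (x : 'rV[R]_n.+1) i : 0 < enorm x < rho ->
  partial i u x = U1 (enorm x) * (x 0 i / enorm x).
Proof.
move=> /andP[x0 xr]; apply: derive_val.
rewrite -[x in is_derive x]addr0 -(scale0r (delta_mx 0 i)).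
apply/is_derive_line.
have Ux : is_derive (enorm (x + 0 *: delta_mx 0 i)) 1 U (U1 (enorm x)).
  by rewrite scale0r addr0; apply: radial_dU; rewrite x0.
have := @is_derive1_comp R U (fun t : R => enorm (x + t *: delta_mx 0 i)) 0 _ _
  Ux (is_derive_norm_line i x0).
apply: near_eq_is_derive; near=> t => /=.
by rewrite uU // /ecball /=; apply: ltW; near: t; exact: line_in_ball.
Unshelve. all: by end_near. Qed.

(** Obtained by differentiating [radial_partial] along each coordinate line through [r *: axis]: the
    radial direction gives [U''], the others [U' / r]. *)
Lemma radial_hessian r : 0 < r < rho ->
  hessian u (r *: axis) =
  diag_mx (\row_j (if j == ord0 then U2 r else U1 r / r)).
Proof.
move=> rr; case/andP: (rr) => r0 rr'.
pose x := r *: axis.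
have xE : enorm x = r by rewrite enorm_axis // ltW.
have x0 : 0 < enorm x by rewrite xE.
have xk k : x 0 k = r * (k == ord0)%:R by rewrite /x !mxE.
apply/matrixP => i j; rewrite !mxE; apply: derive_val.
rewrite -/x -[x in is_derive x]addr0 -(scale0r (delta_mx 0 j)).
apply/is_derive_line.
have U1x : is_derive (enorm (x + 0 *: delta_mx 0 j)) 1 U1 (U2 r).
  by rewrite scale0r addr0 xE; apply: radial_dU1; rewrite (ltW r0).
have dU1 := @is_derive1_comp R U1 (fun t : R => enorm (x + t *: delta_mx 0 j)) 0 _ _
  U1x (is_derive_norm_line j x0).
have dx : is_derive (0 : R) 1 (fun t : R => (x + t *: delta_mx 0 j) 0 i) (i == j)%:R.
  rewrite (_ : (fun _ => _) = fun t : R => x 0 i + t * (i == j)%:R); last first.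
    by apply/funext => t; rewrite !mxE.
  apply: (is_derive_eq (is_derive1D (is_derive1C (x 0 i) 0)
    (is_derive1M (is_derive1I 0) (is_derive1C (i == j)%:R 0)))).
  by ring.
have nz : (fun t : R => enorm (x + t *: delta_mx 0 j)) 0 != 0.
  by rewrite /= scale0r addr0 xE gt_eqF.
have dV := @is_derive1V R (fun t : R => enorm (x + t *: delta_mx 0 j)) 0 _ nz
  (is_derive_norm_line j x0).
have := is_derive1M dU1 (is_derive1M dx dV).
move=> D; refine (is_derive_eq (near_eq_is_derive _ D) _).
  near=> t; rewrite /= [RHS]radial_partial; last first.
    apply/andP; split; near: t; first exact: line_nonzero.
    by apply: line_in_ball; rewrite xE.
  by [].
rewrite /= scale0r addr0 xE !xk.
have r0' : r != 0 by rewrite gt_eqF.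
have [->|i0] := eqVneq i ord0.
  by have [_|_] := eqVneq j ord0; rewrite /x /=; field.
have [<-|ij] := eqVneq i j; first by rewrite (negbTE i0) /x /=; field.
by rewrite /=; field.
Unshelve. all: by end_near. Qed.

End Radial.

(** * The Pucci operator on diagonal matrices, and criticality for equal dimensions *)

Definition pucci_neg (R : realType) (s : pucci_sign) (lam Lam : R) : R :=
  match s with PucciPlus => lam | PucciMinus => Lam end.

Definition pucci_pos (R : realType) (s : pucci_sign) (lam Lam : R) : R :=
  match s with PucciPlus => Lam | PucciMinus => lam end.

(** The characteristic polynomial of a diagonal matrix splits, so [eigenvaluesP] identifies the
    eigenvalues with the entries up to order. *)
Lemma pucci_diag (R : realType) (s : pucci_sign) (lam Lam : R) (n : nat)
    (d : 'rV[R]_n) :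
  pucci s lam Lam (diag_mx d) =
  \sum_(i < n) pucci1 (pucci_neg s lam Lam) (pucci_pos s lam Lam) (d 0 i).
Proof.
have perm_d : perm_eq (eigenvalues (diag_mx d)) [seq d 0 i | i <- index_enum 'I_n].
  apply: eigenvaluesP; rewrite big_map char_poly_trig ?diag_mx_is_trig //.
  by apply: eq_bigr => i _; rewrite mxE eqxx mulr1n.
have posE : \sum_(a <- eigenvalues (diag_mx d) | 0 < a) a =
    \sum_(i < n) Num.max (d 0 i) 0.
  rewrite (perm_big _ perm_d) big_map big_mkcond; apply: eq_bigr => i _.
  by case: ltP => // ?; rewrite ?max_l ?max_r // ltW.
have negE : \sum_(a <- eigenvalues (diag_mx d) | a < 0) a =
    \sum_(i < n) Num.min (d 0 i) 0.
  rewrite (perm_big _ perm_d) big_map big_mkcond; apply: eq_bigr => i _.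
  by case: ltP => // ?; rewrite ?min_l ?min_r // ltW.
rewrite /pucci posE negE /pucci1 big_split /= -!mulr_sumr.
by case: s.
Qed.

(** The sum of the two mixed inequalities is [2 (max - 2) <= (x + y) S]. For [y <= x] this suffices;
    otherwise it is combined with [(x + y) (x - 2) <= 2 x (y - 2)], which amounts to
    [(y - x) (x + 2) >= 0]. *)
Lemma mixed_criticality (R : realFieldType) (x y P Q : R) : 0 < x -> 0 < y ->
  0 < P -> 0 < Q -> Num.max x y - 2 <= x / P + y / Q ->
  Num.max x y - 2 <= y / P + x / Q -> x - 2 <= x / P + x / Q.
Proof.
move=> x0 y0 P0 Q0; pose S := P^-1 + Q^-1 => c1 c2.
have S0 : 0 < S by rewrite addr_gt0 ?invr_gt0.
have {c1 c2} : 2 * (Num.max x y - 2) <= (x + y) * S.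
  rewrite (_ : (x + y) * S = x / P + y / Q + (y / P + x / Q)); last first.
    by rewrite /S; ring.
  lra.
rewrite -mulrDr -/S; have [yx|/ltW xy] := leP y x => c.
  have : (x + y) * S <= 2 * x * S by rewrite ler_pM2r //; lra.
  by move: c; lra.
have xy0 : 0 < x + y by rewrite addr_gt0.
rewrite -subr_ge0 -(pmulr_rge0 _ xy0).
have : 0 <= (y - x) * (x + 2) by rewrite mulr_ge0 ?subr_ge0 // addr_ge0 // ltW.
have : x * (2 * (y - 2)) <= x * ((x + y) * S) by rewrite ler_pM2l.
by move: S0 c; clearbody S; nra.
Qed.

(** * From a radial solution to its profile *)

Section RadialProfile.
Context {R : realType} {n : nat} {s : pucci_sign} {lam Lam p rho : R}.
Context {u v : 'rV[R]_n.+1 -> R} {U V : R -> R}.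
Hypothesis rho0 : 0 < rho.
Hypothesis u_C2 : C2_on (eball rho) u.
Hypothesis u_cont : {within ecball rho, continuous u}.
Hypothesis u_eq : forall x, eball rho x ->
  pucci s lam Lam (hessian u x) + v x `^ p = 0.
Hypothesis u_gt0 : forall x, eball rho x -> 0 < u x.
Hypothesis u_bd : forall x, esphere rho x -> u x = 0.
Hypothesis uU : radial_profile rho u U.
Hypothesis vV : radial_profile rho v V.

Local Notation axis := (delta_mx 0 0 : 'rV[R]_n.+1).
Local Notation U1 := (fun r : R => partial ord0 u (r *: axis)).
Local Notation U2 := (fun r : R => partial ord0 (partial ord0 u) (r *: axis)).

Lemma axis_cvg (r : R) (f : 'rV[R]_n.+1 -> R) : {for r *: axis, continuous f} ->
  f (t *: axis) @[t --> r] --> f (r *: axis).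
Proof.
move=> fc; apply: (@continuous_comp _ _ _ (fun t : R => t *: axis) f r) => //.
exact: scalel_continuous.
Qed.

Lemma origin_in_ball : eball rho (0 : 'rV[R]_n.+1).
Proof. by rewrite /eball /= enorm0. Qed.

(** [u] is even along the axis, so its derivative at 0 equals its own opposite. *)
Lemma U1_origin : U1 0 = 0.
Proof.
have [_ /(_ ord0)[du _] _] := u_C2 origin_in_ball.
have even : is_derive (0 : R) 1 (fun t : R => u (0 + t *: axis)) (U1 0).
  by apply/is_derive_line; rewrite scale0r addr0; split.
have odd : is_derive (0 : R) 1 (fun t : R => u (0 + t *: axis)) (U1 0 * -1).
  have e0 : is_derive (- 0 : R) 1 (fun t : R => u (0 + t *: axis)) (U1 0).
    by rewrite oppr0.
  have := @is_derive1_comp R (fun t : R => u (0 + t *: axis)) (fun t => - t) 0 _ _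
    e0 (is_derive1N (is_derive1I 0)).
  apply: near_eq_is_derive; near=> t; rewrite /= !add0r.
  have tr : enorm (t *: axis) <= rho.
    apply: ltW; rewrite -[_ *: _]add0r; near: t; apply: line_in_ball => //.
    by rewrite enorm0.
  by rewrite !uU /ecball /= ?enorm_axisN.
have := @derive_val _ _ _ _ _ _ _ odd; rewrite (@derive_val _ _ _ _ _ _ _ even).
by lra.
Unshelve. all: by end_near. Qed.

(** As [U1 0 = 0], the ratio is the difference quotient of [U1] at 0. *)
Lemma U1_ratio_cvg0 : U1 r / r @[r --> (0 : R)^'+] --> U2 0.
Proof.
have [|du duE] := radial_dU1 u_C2 (r := 0); first by rewrite lexx.
have : (h^-1 *: ((U1 \o shift 0) (h *: 1) - U1 0)) @[h --> (0 : R)^'] --> U2 0.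
  by rewrite -duE; exact: du.
move=> /cvg_dnbhs_at_right; apply: cvg_trans; apply: near_eq_cvg.
apply: nearW => r; rewrite U1_origin subr0 /= addr0.
by rewrite [r *: 1]mulr1 [LHS]mulrC.
Qed.

Lemma radial_profile_profile :
  profile (pucci_neg s lam Lam) (pucci_pos s lam Lam) n.+1%:R p rho U U1 U2 V.
Proof.
have Uaxis r : 0 <= r <= rho -> u (r *: axis) = U r.
  by move=> /andP[r0 rr]; rewrite uU /ecball /= enorm_axis.
split.
- move=> r /andP[r0 rr]; rewrite -Uaxis; last by rewrite !ltW.
  by apply: u_gt0; apply: axis_in_ball; rewrite (ltW r0).
- by move=> r; exact: radial_dU.
- move=> r /andP[r0 rr].
  exact: (radial_dU1 u_C2 (introT andP (conj (ltW r0) rr))).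
- move=> r rr; case/andP: (rr) => r0 rr'.
  have := u_eq (axis_in_ball (introT andP (conj (ltW r0) rr'))).
  rewrite (radial_hessian rho0 u_C2 uU rr) pucci_diag big_ord_recl mxE eqxx.
  rewrite (eq_bigr (fun=> pucci1 (pucci_neg s lam Lam) (pucci_pos s lam Lam) (U1 r / r))).
    have -> : v (r *: axis) = V r by rewrite vV /ecball /= enorm_axis ?ltW.
    rewrite sumr_const card_ord => <-; congr (_ + _ + _).
    by rewrite -natr1 addrK mulr_natl.
  by move=> i _; rewrite mxE.
- exists (u 0); first exact: u_gt0 origin_in_ball.
  have [u0 _ _] := u_C2 origin_in_ball.
  have : u (t *: axis) @[t --> (0 : R)^'+] --> u 0.
    apply: cvg_at_right_filter; rewrite -[X in _ --> u X](scale0r axis).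
    by apply: axis_cvg; rewrite scale0r.
  apply: cvg_trans; apply: near_eq_cvg; near=> r.
  by rewrite Uaxis //; apply/andP; split; near: r;
    [exact: nbhs_right_ge|exact: nbhs_right_le].
- exists (U2 0); first exact: U1_ratio_cvg0.
  have [_ _ /(_ ord0 ord0)[_ c2]] := u_C2 origin_in_ball.
  apply: cvg_at_right_filter; apply: (@axis_cvg 0 (partial ord0 (partial ord0 u))).
  by rewrite scale0r.
- have rI : ecball rho (rho *: axis) by rewrite /ecball /= enorm_axis // ltW.
  have uc : u x @[x --> within (ecball rho) (nbhs (rho *: axis))] --> (0 : R).
    rewrite -(u_bd (x := rho *: axis)); last by rewrite /esphere /= enorm_axis // ltW.
    by have := u_cont (x := rho *: axis); rewrite /continuous_at (nbhs_subspace_in rI).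
  (* Continuity on the boundary is only relative to the closed ball, so the ray must be seen to
     approach its endpoint within that ball. *)
  have ax : t *: axis @[t --> rho^'-] --> within (ecball rho) (nbhs (rho *: axis)).
    move=> B nB; have nB' := @scalel_continuous R _ axis rho _ nB.
    have tB : \forall t \near rho^'-, ecball rho (t *: axis) -> B (t *: axis).
      by apply: cvg_at_left_filter nB'; exact: cvg_id.
    suff : \forall t \near rho^'-, B (t *: axis) by [].
    near=> t; have BT : ecball rho (t *: axis) -> B (t *: axis) by near: t; exact: tB.
    apply: BT; rewrite /ecball /= enorm_axis; near: t;
      [exact: nbhs_left_le|exact: nbhs_left_ge].
  have := cvg_comp _ _ ax uc.
  apply: cvg_trans; apply: near_eq_cvg; near=> r => /=.
  by rewrite Uaxis //; apply/andP; split; near: r;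
    [exact: nbhs_left_ge|exact: nbhs_left_le].
Unshelve. all: by end_near. Qed.

End RadialProfile.

Theorem corollary4p2 (R : realType) (N : nat) (lam Lam p q : R)
    (s : pucci_sign) (rho : R) (u v : 'rV[R]_N -> R) (U V : R -> R) :
  (3 <= N)%N -> 0 < lam -> lam <= Lam ->
  0 < p -> 0 < q -> 1 < p * q ->
  region_d s lam Lam N (p, q) ->
  0 < rho ->
  regular_solution s lam Lam p q rho u v ->
  radial_profile rho u U -> radial_profile rho v V ->
  changes_concavity_once rho U /\ changes_concavity_once rho V.
Proof.
case: N u v => [//|n] u v n3 lam0 lamLam p0 q0 pq1 region rho0.
move=> [[u_C2 v_C2] [u_cont v_cont] uv_eq uv_gt0 uv_bd] uU vV.
have Lam0 : 0 < Lam by exact: lt_le_trans lamLam.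
pose a := pucci_neg s lam Lam; pose A := pucci_pos s lam Lam.
have a0 : 0 < a by rewrite /a; case: (s).
have A0 : 0 < A by rewrite /A; case: (s).
have n1 : 1 < n.+1%:R :> R by rewrite ltr1n; exact: leq_trans n3.
have H : profile a A n.+1%:R p rho U _ _ V :=
  radial_profile_profile rho0 u_C2 u_cont (fun x xr => (uv_eq x xr).1)
    (fun x xr => (uv_gt0 x xr).1) (fun x xr => (uv_bd x xr).1) uU vV.
have H' : profile a A n.+1%:R q rho V _ _ U :=
  radial_profile_profile rho0 v_C2 v_cont (fun x xr => (uv_eq x xr).2)
    (fun x xr => (uv_gt0 x xr).2) (fun x xr => (uv_bd x xr).2) vV uU.
pose x := regime a A n.+1%:R true; pose y := regime a A n.+1%:R false.
have x0 : 0 < x := lt_trans ltr01 (regime_gt1 a0 A0 n1 true).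
have y0 : 0 < y := lt_trans ltr01 (regime_gt1 a0 A0 n1 false).
have p10 : 0 < p + 1 by rewrite addr_gt0.
have q10 : 0 < q + 1 by rewrite addr_gt0.
have [xy yx] : Num.max x y - 2 <= x / (p + 1) + y / (q + 1) /\
               Num.max x y - 2 <= y / (p + 1) + x / (q + 1).
  have n0 : 0 <= n.+1%:R - 1 :> R by rewrite subr_ge0 ltW.
  have yE : y = Ntilde s lam Lam n.+1.
    by rewrite /y /regime /a /A /Ntilde; case: (s) => /=; rewrite mulrAC.
  (* Since [lam <= Lam], the constant [K] of [region_d] is the larger of the two dimensions for
     either sign. *)
  have KE : Num.max x y = match s with PucciPlus => n.+1%:R
                                     | PucciMinus => Ntilde s lam Lam n.+1 end.
    rewrite yE /x /regime /Ntilde; case: (s); [apply: max_l|apply: max_r].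
      rewrite -lerBrDr ler_piMl // ler_pdivrMr // mul1r //.
    rewrite -lerBlDr ler_peMl // ler_pdivlMr // mul1r //.
  by rewrite KE yE; case: region => /= _ _ /ltW + /ltW.
(* Mixed pairs are the inequalities of the region; equal pairs come from [mixed_criticality]. *)
have crit b b' : Num.max (regime a A n.+1%:R b) (regime a A n.+1%:R b') - 2 <=
    regime a A n.+1%:R b / (p + 1) + regime a A n.+1%:R b' / (q + 1).
  case: b; case: b'; rewrite -/x -/y ?maxxx.
  - exact: mixed_criticality xy yx.
  - exact: xy.
  - by rewrite maxC.
  - by apply: (@mixed_criticality _ y x) => //; rewrite maxC.
have HO := profile_half_orbit a0 A0 n1 rho0 p0 H H'.
have HO' := profile_half_orbit a0 A0 n1 rho0 q0 H' H.
have crit' b b' : Num.max (regime a A n.+1%:R b) (regime a A n.+1%:R b') - 2 <=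
    regime a A n.+1%:R b / (q + 1) + regime a A n.+1%:R b' / (p + 1).
  by rewrite maxC [leRHS]addrC.
have qp1 : 1 < q * p by rewrite mulrC.
have growU := growth_ge0 a0 A0 n1 rho0 HO HO' p0 q0 pq1 crit.
have growV := growth_ge0 a0 A0 n1 rho0 HO' HO q0 p0 qp1 crit'.
(* For each component, the nonnegative growth of its partner gives the decay required by
   [profile_concavity]. *)
split.
- apply: (profile_concavity a0 A0 n1 rho0 p0 H H') => r /andP[r0 rr].
  apply: (orbit_Z_decay a0 A0 HO HO' p0); first by rewrite r0.
  by move=> z /andP[z0 zr]; apply: growV; rewrite z0 (le_lt_trans zr).
- apply: (profile_concavity a0 A0 n1 rho0 q0 H' H) => r /andP[r0 rr].
  apply: (orbit_Z_decay a0 A0 HO' HO q0); first by rewrite r0.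
  by move=> z /andP[z0 zr]; apply: growU; rewrite z0 (le_lt_trans zr).
Qed.
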